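(* Let $D=\{z_i=(x_i,y_i)\}_{i=1}^m$ be a training set with $x_i\in\mathbb{R}^p$, $y_i\in\mathbb{R}$, and let $\mathcal{D}_X$ be the empirical distribution of $x_1,\dots,x_m$. Let $f_\theta$ and $h$ be twice differentiable and let $l(\theta,z)=h(f_\theta(x))-yf_\theta(x)$. Fix $n\ge2$ and $\pmb\alpha=(\alpha_1,\dots,\alpha_n)$ with $\alpha_k>0$, and define the $n$-Mixup loss $$L^{\text{n-mix}}_m(\theta)=\frac{1}{m^n}\sum_{\mathbf{i}=(i_1,\dots,i_n)\in[m]^n}\mathbb{E}_{\pmb\lambda\sim\mathrm{Dir}(\pmb\alpha)}\,l\Big(\theta,\Big(\sum_{k=1}^n\lambda_kx_{i_k},\ \sum_{k=1}^n\lambda_ky_{i_k}\Big)\Big).$$ Let $\tilde{\mathcal{D}}_\Lambda=\sum_{l=1}^n\frac{\alpha_l}{\sum_{i}\alpha_i}\mathrm{Dir}(\alpha_l+1,\alpha_{l+1},\dots,\alpha_{l+n-1})$ (indices taken mod $n$), and let $L_m(\theta)=\frac1m\sum_{i=1}^m l(\theta,z_i)$. Then $$L^{\text{n-mix}}_m(\theta)=L_m(\theta)+\mathcal{R}_1(\theta)+\mathcal{R}_2(\theta)+\mathcal{R}_3(\theta)+\mathbb{E}_{\pmb\lambda\sim\tilde{\mathcal{D}}_\Lambda}\big[o(\|(\lambda_2,\dots,\lambda_n)\|^2)\big],$$ where, with all expectations over $r_x$ taken with $r_x\sim\mathcal{D}_X$ and over $\pmb\lambda$ with $\pmb\lambda\sim\tilde{\mathcal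 D}_\Lambda$, $$\mathcal{R}_1(\theta)=\frac{\mathbb{E}[1-\lambda_1]}{m}\sum_{i=1}^m\big(h'(f_\theta(x_i))-y_i\big)\nabla f_\theta(x_i)^\intercal\,\mathbb{E}[r_x-x_i],$$ $$\mathcal{R}_2(\theta)=\frac{\mathbb{E}[\sum_{j=2}^n\lambda_j^2]}{2m}\sum_{i=1}^m h''(f_\theta(x_i))\,\nabla f_\theta(x_i)^\intercal\,\mathbb{E}[(r_x-x_i)(r_x-x_i)^\intercal]\,\nabla f_\theta(x_i)+\frac{\mathbb{E}[(1-\lambda_1)^2-\sum_{j=2}^n\lambda_j^2]}{2m}\sum_{i=1}^m h''(f_\theta(x_i))\,\nabla f_\theta(x_i)^\intercal\,\mathbb{E}[r_x-x_i]\,\mathbb{E}[r_x-x_i]^\intercal\,\nabla f_\theta(x_i),$$ $$\mathcal{R}_3(\theta)=\frac{\mathbb{E}[\sum_{j=2}^n\lambda_j^2]}{2m}\sum_{i=1}^m\big(h'(f_\theta(x_i))-y_i\big)\,\mathbb{E}\big[(r_x-x_i)^\intercal\nabla^2f_\theta(x_i)(r_x-x_i)\big]+\frac{\mathbb{E}[(1-\lambda_1)^2-\sum_{j=2}^n\lambda_j^2]}{2m}\sum_{i=1}^m\big(h'(f_\theta(x_i))-y_i\big)\,\mathbb{E}[r_x-x_i]^\intercal\,\nabla^2f_\theta(x_i)\,\mathbb{E}[r_x-x_i].$$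
   Context: $\mathrm{Dir}(\pmb\alpha)$ is the Dirichlet distribution on the simplex $\{\pmb\lambda\in[0,1]^n:\sum_k\lambda_k=1\}$. $\nabla f_\theta$, $\nabla^2 f_\theta$ are the gradient and Hessian of $f_\theta$ with respect to its input. $o(\|(\lambda_2,\dots,\lambda_n)\|^2)$ denotes a Taylor remainder term which, divided by $\|(\lambda_2,\dots,\lambda_n)\|^2$, tends to $0$ as $(\lambda_2,\dots,\lambda_n)\to 0$. *)

(* Defs.v *)
From mathcomp Require Import all_boot all_order all_algebra.
From mathcomp Require Import all_classical all_reals all_analysis.
Import numFieldNormedType.Exports.
Import Order.TTheory GRing.Theory Num.Theory.

Set Implicit Arguments.
Unset Strict Implicit.
Unset Printing Implicit Defensive.

Local Open Scope ring_scope.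

Section NMixup.
Variable R : realType.

Fixpoint iint (k : nat) (F : seq R -> R) : R :=
  match k with
  | 0 => F [::]
  | k'.+1 => Rintegral (@lebesgue_measure R) setT
               (fun t : R => iint k' (fun s => F (t :: s)))
  end.

(* A point of the simplex in R^n is parametrized by s = (lambda_2,...,lambda_n);
   coordinate 0 (i.e. lambda_1) is 1 - sum s. *)
Definition lamN (s : seq R) (k : nat) : R :=
  if k is k'.+1 then nth 0 s k' else 1 - \sum_(t <- s) t.

Definition dir_w (n : nat) (beta : 'I_n -> R) (s : seq R) : R :=
  if all (fun t => 0 <= t) s && (0 <= 1 - \sum_(t <- s) t)
  then \prod_(k < n) (lamN s k) `^ (beta k - 1) else 0.

Definition dirE (n : nat) (beta : 'I_n -> R) (F : ('I_n -> R) -> R) : R :=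
  iint n.-1 (fun s => dir_w beta s * F (fun k : 'I_n => lamN s k))
  / iint n.-1 (dir_w beta).

Definition cyc (n : nat) (a : 'I_n -> R) (j : nat) : R :=
  if (insub (j %% n)%N : option 'I_n) is Some i then a i else 0.

Definition mixbeta (n : nat) (a : 'I_n -> R) (l : 'I_n) : 'I_n -> R :=
  fun k => cyc a (l + k)%N + (if val k == 0%N then 1 else 0).

Definition tildeE (n : nat) (a : 'I_n -> R) (F : ('I_n -> R) -> R) : R :=
  \sum_(l < n) (a l / \sum_(i < n) a i) * dirE (mixbeta a l) F.

Definition grad (p : nat) (g : 'rV[R]_p -> R) (z : 'rV[R]_p) : 'rV[R]_p :=
  \row_j 'D_(delta_mx 0 j : 'rV[R]_p) g z.

Definition hess (p : nat) (g : 'rV[R]_p -> R) (z : 'rV[R]_p) : 'M[R]_p :=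
  \matrix_(j, k) 'D_(delta_mx 0 j : 'rV[R]_p) ('D_(delta_mx 0 k : 'rV[R]_p) g) z.

Variables (p m n : nat) (x : 'I_m -> 'rV[R]_p) (y : 'I_m -> R)
          (h : R -> R) (f : 'rV[R]_p -> R) (alpha : 'I_n -> R) (k0 : 'I_n).
(* f stands for f_theta (theta fixed); k0 is the index of lambda_1. *)

Definition loss (z : 'rV[R]_p) (yy : R) : R := h (f z) - yy * f z.

Definition Lm : R := m%:R^-1 * \sum_(i < m) loss (x i) (y i).

Definition Lnmix : R :=
  (m%:R ^+ n)^-1 * \sum_(i : {ffun 'I_n -> 'I_m})
     dirE alpha (fun lam => loss (\sum_(k < n) lam k *: x (i k))
                                 (\sum_(k < n) lam k * y (i k))).

Definition EX (i : 'I_m) : 'rV[R]_p := m%:R^-1 *: \sum_(j < m) (x j - x i).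
Definition EXX (i : 'I_m) : 'M[R]_p :=
  m%:R^-1 *: \sum_(j < m) ((x j - x i)^T *m (x j - x i)).
Definition EquadH (i : 'I_m) (H : 'M[R]_p) : R :=
  m%:R^-1 * \sum_(j < m) ((x j - x i) *m H *m (x j - x i)^T) 0 0.

Definition sq_rest (lam : 'I_n -> R) : R := \sum_(k < n | k != k0) lam k ^+ 2.

Definition R1 : R :=
  tildeE alpha (fun lam => 1 - lam k0) / m%:R *
  \sum_(i < m) (derive1 h (f (x i)) - y i) * (grad f (x i) *m (EX i)^T) 0 0.

Definition R2 : R :=
  tildeE alpha sq_rest / (2 * m%:R) *
    \sum_(i < m) derive1 (derive1 h) (f (x i)) *
        (grad f (x i) *m EXX i *m (grad f (x i))^T) 0 0
  + tildeE alpha (fun lam => (1 - lam k0) ^+ 2 - sq_rest lam) / (2 * m%:R) *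
    \sum_(i < m) derive1 (derive1 h) (f (x i)) *
        (grad f (x i) *m (EX i)^T *m EX i *m (grad f (x i))^T) 0 0.

Definition R3 : R :=
  tildeE alpha sq_rest / (2 * m%:R) *
    \sum_(i < m) (derive1 h (f (x i)) - y i) * EquadH i (hess f (x i))
  + tildeE alpha (fun lam => (1 - lam k0) ^+ 2 - sq_rest lam) / (2 * m%:R) *
    \sum_(i < m) (derive1 h (f (x i)) - y i) *
        (EX i *m hess f (x i) *m (EX i)^T) 0 0.

(* Second-order Taylor remainder, in (lambda_2..lambda_n) around 0, of
   lambda |-> l(theta, (sum_k lambda_k x_(i_k), y_(i_1))) with lambda_1 = 1 - sum_(k>=2) lambda_k,
   i.e. of  l(theta, (x_(i_1) + delta, y_(i_1))),  delta = sum_(k>=2) lambda_k (x_(i_k) - x_(i_1)). *)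
Definition mix_delta (i : {ffun 'I_n -> 'I_m}) (lam : 'I_n -> R) : 'rV[R]_p :=
  \sum_(k < n | k != k0) lam k *: (x (i k) - x (i k0)).

Definition taylor_rem (i : {ffun 'I_n -> 'I_m}) (lam : 'I_n -> R) : R :=
  let x1 := x (i k0) in let y1 := y (i k0) in let d := mix_delta i lam in
  let g := grad f x1 in let H := hess f x1 in
  loss (x1 + d) y1
  - (loss x1 y1
     + (derive1 h (f x1) - y1) * (g *m d^T) 0 0
     + 2^-1 * (derive1 h (f x1) - y1) * (d *m H *m d^T) 0 0
     + 2^-1 * derive1 (derive1 h) (f x1) * ((g *m d^T) 0 0) ^+ 2).

Definition Rrem : R :=
  tildeE alpha (fun lam => (m%:R ^+ n)^-1 * \sum_(i : {ffun 'I_n -> 'I_m}) taylor_rem i lam).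

End NMixup.

Lemma two_le_gt0 (n : nat) : (2 <= n)%N -> (0 < n)%N.
Proof. by move=> hn; apply: leq_trans hn. Qed.

(* Main.v *)
Require Import Defs.
From HB Require Import structures.
From mathcomp Require Import all_boot all_order all_algebra.
From mathcomp Require Import all_classical all_reals all_analysis.
From mathcomp Require Import measurable_realfun.
From mathcomp Require Import ring lra.
Import numFieldNormedType.Exports.
Import Order.TTheory GRing.Theory Num.Theory.
Set Implicit Arguments.
Unset Strict Implicit.
Unset Printing Implicit Defensive.
Local Open Scope classical_set_scope.
Local Open Scope ring_scope.

(** The loss is affine in the label, so the mixed label splits it into the sum over l of lambda_l
    times the loss at the mixed input with the single label y_(i_l). Under Dir(alpha) a factor
    lambda_l is a size-biasing: it raises alpha_l by one and costs alpha_l / sum alpha. Dirichlet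
    laws are equivariant under cyclic relabelling and the average over index tuples is invariant
    under it, so the l-th term can be turned until its label comes first. Summing over l gives
    exactly the expectation under the mixture [tildeE] ([dirE_mix], [Lnmix_tildeE]).

    As the lambda_k sum to 1, the mixed input is x_(i_1) + delta with delta = sum over k >= 2 of
    lambda_k (x_(i_k) - x_(i_1)). The loss is expanded to second order at x_(i_1) and, for fixed
    lambda, averaged over tuples, whose entries behave as independent uniform draws. The linear term
    carries the weight 1 - lambda_1; in the quadratic term equal index pairs give a second moment
    and distinct pairs a product of means ([avg_taylor]). The Hessian of the loss is (h' - y) times
    the Hessian of f plus h'' times a rank-one term, which separates [R3] from [R2]. Linearity of
    [tildeE] yields the identity ([Lnmix_taylor]); the remainder is small by a Peano estimate
    ([taylor_peano2], [taylor_rem_littleo]).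

    The analytic work is in the Dirichlet integrals, which are iterated integrals of a density
    possibly unbounded near the faces. Integrability is tracked at every level ([hered]) and
    obtained by domination by Dirichlet weights ([tame], [hered_Wrec]). Rotation invariance is
    Fubini plus a reflection of one coordinate ([iint_rotS]). Applied to the normaliser, it also
    gives the Beta recurrence behind size-biasing ([betaR_rS]). *)

(** * Iterated Lebesgue integrals of functions on lists *)

Section IteratedIntegral.
Variable R : realType.
Notation mu := (@lebesgue_measure R).
Notation RT := (measurableTypeR R).
Implicit Types (F G H : seq R -> R) (k : nat) (s : seq R).

(** Tonelli gives measurability of partial integrals of nonnegative functions, hence the split into
    positive and negative parts. *)
Lemma measurable_Rintegral_param d (T : measurableType d) (f : T * RT -> R) :
  measurable_fun setT f ->
  measurable_fun setT (fun x => Rintegral mu setT (fun t => f (x, t))).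
Proof.
move=> mf; apply: (measurableT_comp (fine_measurable measurableT)).
rewrite (_ : (fun x : T => _) = (fun x => \int[mu]_t ((EFin \o f)^\+ (x, t)))
  \- (fun x => \int[mu]_t ((EFin \o f)^\- (x, t))))%E; last first.
  apply/funext => x; rewrite integralE.
  by congr (_ - _)%E; apply: eq_integral => t _; rewrite ?funeposE ?funenegE.
have mf' : measurable_fun setT (EFin \o f) by exact/measurable_EFinP.
apply: emeasurable_funB; apply: (@measurable_fun_fubini_tonelli_F _ _ T RT _ mu).
- exact: measurable_funepos.
- by move=> ?; exact: funepos_ge0.
- exact: measurable_funeneg.
- by move=> ?; exact: funeneg_ge0.
Qed.

(** The parameter space is arbitrary because the induction moves the outermost integration variable
    into it, replacing [T] by [T * RT]. *)
Lemma measurable_iint_param k d (T : measurableType d) (f : T -> seq R -> R) :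
  measurable_fun setT (fun z : T * k.-tuple RT => f z.1 z.2) ->
  measurable_fun setT (fun x => iint k (f x)).
Proof.
elim: k d T f => [|k IH] d T f mf /=.
  by apply: (measurableT_comp mf (g := fun x => (x, [tuple]))); exact: measurable_fun_pair.
apply: (@measurable_Rintegral_param _ T (fun z => iint k (fun s => f z.1 (z.2 :: s)))).
apply: (IH _ _ (fun z : T * RT => fun s => f z.1 (z.2 :: s))).
pose phi (z : T * RT * k.-tuple RT) := (z.1.1, [the k.+1.-tuple RT of z.1.2 :: z.2]).
apply: (measurableT_comp mf (g := phi)).
apply: measurable_fun_pair => /=; first exact: measurableT_comp.
by apply: measurable_cons => //; exact: measurableT_comp.
Qed.

(** Lists of length [k] are viewed as tuples, which carry the product sigma-algebra. *)
Definition smeas k F := measurable_fun setT (fun t : k.-tuple RT => F t).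

Lemma smeas_joint k F : smeas k.+1 F ->
  measurable_fun setT (fun z : RT * k.-tuple RT => F (z.1 :: z.2)).
Proof.
move=> mF.
apply: (measurableT_comp mF (g := fun z : RT * k.-tuple RT => [the k.+1.-tuple RT of z.1 :: z.2])).
exact: measurable_cons.
Qed.

Lemma smeas_cons k F t : smeas k.+1 F -> smeas k (fun s => F (t :: s)).
Proof.
move=> /smeas_joint mF.
by apply: (measurableT_comp mF (g := fun z : k.-tuple RT => (t : RT, z))); exact: measurable_fun_pair.
Qed.

Lemma smeas_iint k F : smeas k.+1 F ->
  measurable_fun setT (fun t : RT => iint k (fun s => F (t :: s))).
Proof.
by move=> /smeas_joint mF; apply: (measurable_iint_param (f := fun t s => F (t :: s))).
Qed.

(** Integrability at every level of the iteration, which linearity and monotonicity of [iint]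
    require. Sections are controlled for every [t], not almost every one, so that inner integrals
    can be rewritten pointwise. *)
Fixpoint hered k F : Prop :=
  if k is k'.+1 then
    (forall t, hered k' (fun s => F (t :: s))) /\
    mu.-integrable setT (EFin \o (fun t : R => iint k' (fun s => F (t :: s))))
  else True.

Lemma heredS k F : hered k.+1 F = ((forall t, hered k (fun s => F (t :: s))) /\
  mu.-integrable setT (EFin \o (fun t : R => iint k (fun s => F (t :: s))))).
Proof. by []. Qed.

Lemma iint_ext k F G : (forall s, size s = k -> F s = G s) -> iint k F = iint k G.
Proof.
elim: k F G => [|k IH] F G FG /=; first exact: FG.
apply: eq_Rintegral => t _; apply: IH => s sk; apply: FG; by rewrite /= sk.
Qed.

Lemma hered_ext k F G : (forall s, size s = k -> F s = G s) -> hered k F -> hered k G.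
Proof.
elim: k F G => [//|k IH] F G FG; rewrite !heredS => -[hF iF].
have E t s : size s = k -> F (t :: s) = G (t :: s) by move=> sk; apply: FG; rewrite /= sk.
split=> [t|]; first exact: (IH _ _ (E t) (hF t)).
by rewrite (_ : _ \o _ = EFin \o (fun t => iint k (fun s => F (t :: s))))//;
  apply/funext => t /=; rewrite (iint_ext (E t)).
Qed.

Lemma hered_lin k F G (a : R) : hered k F -> hered k G ->
  hered k (fun s => a * F s + G s) /\
  iint k (fun s => a * F s + G s) = a * iint k F + iint k G.
Proof.
elim: k F G => [//|k IH] F G; rewrite !heredS => -[hF iF] [hG iG].
have E t := IH _ _ (hF t) (hG t).
have iaF : mu.-integrable setT (EFin \o (fun t => a * iint k (fun s => F (t :: s)))).
  exact: (integrableZl measurableT a iF).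
split; first split.
- by move=> t; case: (E t).
- rewrite (_ : _ \o _ =
    ((EFin \o (fun t => a * iint k (fun s => F (t :: s)))%R) \+
     (EFin \o (fun t => iint k (fun s => G (t :: s)))))%E); last first.
    by apply/funext => t /=; rewrite (E t).2 EFinD.
  exact: integrableD.
- move=> /=; under eq_Rintegral => t _ do rewrite (E t).2.
  by rewrite RintegralD// RintegralZl.
Qed.

Lemma hered0 k : hered k (fun=> 0) /\ iint k (fun=> 0 : R) = 0.
Proof.
elim: k => [//|k [h i]]; rewrite heredS /=; split; first split=> //.
- by rewrite i; exact: integrable0.
- by rewrite i Rintegral_cst// mul0r.
Qed.

Lemma heredZ k F a : hered k F ->
  hered k (fun s => a * F s) /\ iint k (fun s => a * F s) = a * iint k F.
Proof.
move=> hF; have [h0 i0] := hered0 k.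
have [h i] := hered_lin a hF h0; split.
  by apply: hered_ext h => s _; rewrite addr0.
by rewrite -[RHS]addr0 -i0 -i; apply: iint_ext => s _; rewrite addr0.
Qed.

Lemma heredD k F G : hered k F -> hered k G ->
  hered k (fun s => F s + G s) /\ iint k (fun s => F s + G s) = iint k F + iint k G.
Proof.
move=> hF hG; have [h i] := hered_lin 1 hF hG; split.
  by apply: hered_ext h => s _; rewrite mul1r.
by rewrite -[iint k F]mul1r -i; apply: iint_ext => s _; rewrite mul1r.
Qed.

Lemma hered_sum k (I : finType) (F : I -> seq R -> R) : (forall i, hered k (F i)) ->
  hered k (fun s => \sum_i F i s) /\
  iint k (fun s => \sum_i F i s) = \sum_i iint k (F i).
Proof.
move=> hF; rewrite unlock; elim: index_enum => [|i r [h e]] /=; first exact: hered0.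
by rewrite -e; exact: heredD.
Qed.

Lemma iint_le k F G : hered k F -> hered k G ->
  (forall s, size s = k -> F s <= G s) -> iint k F <= iint k G.
Proof.
elim: k F G => [|k IH] F G; first by move=> _ _ /= ->.
rewrite !heredS => -[hF iF] [hG iG] FG /=; apply: le_Rintegral => // t _.
by apply: IH => // s sk; apply: FG; rewrite /= sk.
Qed.

(** Domination is inherited by partial integrals: from -H <= F <= H on sections follows the same
    bound between their iterated integrals, so each level is dominated by the corresponding level of
    [H]. *)
Lemma hered_dom k F H : smeas k F -> hered k H ->
  (forall s, size s = k -> `|F s| <= H s) -> hered k F.
Proof.
elim: k F H => [//|k IH] F H mF; rewrite !heredS => -[hH iH] FH.
have FHt t s : size s = k -> `|F (t :: s)| <= H (t :: s) by move=> sk; apply: FH; rewrite /= sk.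
have hF t : hered k (fun s => F (t :: s)) by exact: (IH _ _ (smeas_cons t mF) (hH t) (FHt t)).
split=> //; apply: le_integrable iH => //.
  by apply/measurable_EFinP; exact: (smeas_iint mF).
move=> t _; rewrite /= lee_fin; apply: le_trans (ler_norm _).
have [hN iN] := heredZ (-1) (hH t).
rewrite ler_norml -mulN1r -iN.
by apply/andP; split; apply: iint_le => // s sk; have := FHt t s sk;
  rewrite ?mulN1r ler_norml => /andP[].
Qed.

End IteratedIntegral.

(** * Affine substitution, power functions and Beta integrals *)

Section Beta.
Variable R : realType.
Notation mu := (@lebesgue_measure R).
Notation RT := (measurableTypeR R).

Lemma measurable_affine (a b : R) : measurable_fun setT (fun x : RT => a * x + b : RT).
Proof. by apply: measurable_funD => //; exact: measurable_funM. Qed.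

(** Lebesgue measure is determined by its values on half-open intervals, and |a| times its image
    under x -> a x + b has these values. For a < 0 the preimage of such an interval is closed at the
    other end, hence the two cases. *)
Lemma ge0_integral_affine (a b : R) (f : RT -> \bar R) : a != 0 ->
  measurable_fun setT f -> (forall x, 0 <= f x)%E ->
  (\int[mu]_x f x = `|a|%:E * \int[mu]_x f (a * x + b)%R)%E.
Proof.
move=> a0 mf f0.
pose phi : RT -> RT := fun x => a * x + b.
have mphi : measurable_fun setT phi by exact: measurable_affine.
pose mphi_mixin := isMeasurableFun.Build _ _ _ _ _ mphi.
pose mphi_pack : {mfun _ >-> _} := HB.pack phi mphi_mixin.
have ap : 0 <= `|a| by [].
pose k : {nonneg R} := NngNum ap.
have E A : measurable A -> mu A = mscale k (pushforward mu mphi_pack) A.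
  apply: lebesgue_measure_unique => /= _ [[x y]] _ <-.
  rewrite /mscale /= /pushforward.
  have [alt|agt] := ltP a 0.
    rewrite (_ : _ @^-1` _ = `[(y - b) / a, (x - b) / a[%classic).
      rewrite !lebesgue_measure_itv /= !lte_fin ltr_nM2r ?invr_lt0// ltrD2r.
      case: ifP => [_|]; last by rewrite mule0.
      rewrite -!EFinB -EFinM; congr EFin; rewrite ltr0_norm//; by field; rewrite a0.
    apply/seteqP; split=> t /=; rewrite !in_itv/= /phi;
      rewrite ler_ndivrMr// ltr_ndivlMr//; lra.
  have {}agt : 0 < a by rewrite lt_neqAle eq_sym a0.
  rewrite (_ : _ @^-1` _ = `](x - b) / a, (y - b) / a]%classic).
    rewrite !lebesgue_measure_itv /= !lte_fin ltr_pM2r ?invr_gt0// ltrD2r.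
    case: ifP => [_|]; last by rewrite mule0.
    rewrite -!EFinB -EFinM; congr EFin; rewrite gtr0_norm//; by field; rewrite a0.
  apply/seteqP; split=> t /=; rewrite !in_itv/= /phi;
      rewrite ler_pdivlMr// ltr_pdivrMr//; lra.
rewrite (eq_measure_integral (mscale k (pushforward mu mphi_pack))); last by move=> A mA _; exact: E.
rewrite ge0_integral_mscale//= ge0_integral_pushforward//.
Qed.

(** [fine] sends infinite values to 0, so a positive scalar comes out even when the positive or the
    negative part of an integral diverges. *)
Lemma fineZB (c : R) (A B : \bar R) : 0 < c -> (0 <= A)%E -> (0 <= B)%E ->
  fine (c%:E * A - c%:E * B)%E = c * fine (A - B)%E.
Proof.
move=> c0; case: A => [a| |] //; case: B => [b| |] // _ _.
- by rewrite -!EFinM -!EFinB /= mulrBr.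
- by rewrite mulry gtr0_sg// mul1e /= mulr0.
- by rewrite mulry gtr0_sg// mul1e /= mulr0.
- by rewrite mulry gtr0_sg// mul1e /= mulr0.
Qed.

Lemma Rintegral_affine (a b : R) (f : R -> R) : a != 0 ->
  measurable_fun (setT : set RT) f ->
  Rintegral mu setT f = `|a| * Rintegral mu setT (fun x => f (a * x + b)).
Proof.
move=> a0 mf; have mf' : measurable_fun (setT : set RT) (EFin \o f) by exact/measurable_EFinP.
rewrite /Rintegral integralE [in RHS]integralE.
rewrite (ge0_integral_affine b a0 (measurable_funepos mf')) //.
rewrite (ge0_integral_affine b a0 (measurable_funeneg mf')) //.
rewrite fineZB ?normr_gt0//; [|exact: integral_ge0|exact: integral_ge0].
by congr (_ * fine (_ - _)%E); apply: eq_integral => x _; rewrite ?funeposE ?funenegE.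
Qed.

Lemma integrable_affine (a b : R) (f : R -> R) : a != 0 ->
  mu.-integrable setT (EFin \o f) ->
  mu.-integrable setT (EFin \o (fun x => f (a * x + b))).
Proof.
move=> a0 /integrableP[mf fi]; apply/integrableP; split.
  exact: (measurableT_comp mf (measurable_affine a b)).
move: fi; rewrite (ge0_integral_affine b a0) //; last exact: measurableT_comp.
rewrite /comp => fi; rewrite ltey; apply/negP => /eqP E.
by move: fi; rewrite E mulry gtr0_sg ?normr_gt0// mul1e.
Qed.

Definition pw (a t : R) : R := if 0 <= t then t `^ (a - 1) else 0.
Definition pws (a t : R) : R := if 0 < t then t `^ (a - 1) else 0.

Lemma pw_ge0 a t : 0 <= pw a t. Proof. by rewrite /pw; case: ifP => // _; exact: powR_ge0. Qed.
Lemma pws_ge0 a t : 0 <= pws a t. Proof. by rewrite /pws; case: ifP => // _; exact: powR_ge0. Qed.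

Lemma pw_pws a t : t != 0 -> pw a t = pws a t.
Proof. by move=> t0; rewrite /pw /pws lt_neqAle eq_sym t0. Qed.

Lemma measurable_pw a : measurable_fun (setT : set RT) (pw a).
Proof.
by apply: measurable_fun_ifT => //; exact: measurable_fun_ler.
Qed.

Lemma measurable_pws a : measurable_fun (setT : set RT) (pws a).
Proof.
by apply: measurable_fun_ifT => //; exact: measurable_fun_ltr.
Qed.

(** For s < 1 the integrand blows up at 0, so the fundamental theorem of calculus is applied on
    [e i, 1] and monotone convergence lets e i tend to 0. *)
Lemma integral_powR01 (s : R) : 0 < s ->
  (\int[mu]_(t in `]0%R, 1%R]) (t `^ (s - 1))%:E = (s^-1)%:E)%E.
Proof.
move=> s0; have sn0 : s != 0 by rewrite gt_eqF.
(* Starting at 1/2 keeps e i < 1, so every interval is nondegenerate. *)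
pose e (i : nat) : R := i.+2%:R^-1.
have e0 i : 0 < e i by rewrite invr_gt0.
have e1 i : e i < 1 by rewrite invf_lt1// ltr1n.
pose F (i : nat) : set R := `[e i, 1%R]%classic.
have UF : `]0%R, 1%R]%classic = \bigcup_i F i.
  apply/seteqP; split=> t /=; rewrite ?in_itv/=.
    move=> /andP[t0 t1]; have [n] := ltr_add_invr t0.
    rewrite add0r => h; exists n => //; rewrite /F /= in_itv /= t1 andbT.
    by apply: ltW; apply: le_lt_trans h; rewrite lef_pV2 ?posrE// ler_nat.
  by move=> [n _]; rewrite /F /= in_itv /= => /andP[h ->]; rewrite (lt_le_trans (e0 n)).
have Fi i : (\int[mu]_(t in F i) (t `^ (s - 1))%:E = (s^-1 * (1 - e i `^ s))%:E)%E.
  pose f t : R := t `^ (s - 1); pose G t : R := s^-1 * t `^ s.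
  have dG (t : R) : 0 < t -> is_derive t (1 : R) G (f t).
    move=> t0; have tI : t \in `]0, +oo[ by rewrite in_itv/= t0.
    have dt : derivable (@powR R ^~ s) t 1 by exact: derivable_powR.
    apply: DeriveDef; first exact: derivableZ.
    rewrite deriveZ//= -derive1E powR_derive1//.
    by rewrite /f /GRing.scale/= mulrA mulVf// mul1r.
  have cG (t : R) : 0 < t -> {for t, continuous G}.
    by move=> t0; apply/differentiable_continuous/derivable1_diffP; case: (dG t t0).
  have cf (t : R) : 0 < t -> {for t, continuous f}.
    move=> t0; apply/differentiable_continuous/derivable1_diffP.
    by apply: derivable_powR; rewrite in_itv/= t0.
  rewrite (@continuous_FTC2 _ f G (e i) 1) //.
  - by rewrite -EFinB /G powR1 mulrBr.
  - apply: continuous_in_subspaceT => t; rewrite inE/= in_itv/= => /andP[h _].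
    by apply: cf; exact: lt_le_trans h.
  - split=> [t||].
    + by rewrite in_itv/= => /andP[h _]; case: (dG t (lt_trans (e0 i) h)).
    + exact: (cvg_at_right_filter (cG _ (e0 i))).
    + exact: (cvg_at_left_filter (cG _ ltr01)).
  - move=> t; rewrite in_itv/= => /andP[h _]; rewrite derive1E.
    by have [_ ->] := dG t (lt_trans (e0 i) h).
have C : (\int[mu]_(t in F i) (t `^ (s - 1))%:E)%E @[i --> \oo] -->
    (\int[mu]_(t in `]0%R, 1%R]) (t `^ (s - 1))%:E)%E.
  rewrite UF; apply: ge0_nondecreasing_set_cvg_integral => //.
  - apply/nondecreasing_seqP => n; apply/subsetPset => t; rewrite /F /= !in_itv/=.
    move=> /andP[h ->]; rewrite andbT; apply: le_trans h.
    by rewrite lef_pV2 ?posrE// ler_nat.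
  - by move=> i; exact: measurable_itv.
  - by move=> i; apply/measurable_EFinP; apply: measurable_funTS; exact: measurable_powR.
  - by move=> i t _; rewrite lee_fin powR_ge0.
rewrite -(cvg_lim _ C)//; apply/cvg_lim => //.
under eq_fun do rewrite Fi.
apply: cvg_EFin; first exact: nearW.
have C0 : (fun i => e i `^ s) @ \oo --> (0 : R).
  have /cvg_at_rightP := @powR_cvg0 R s s0.
  apply; split=> //; rewrite /e.
  by have := @cvg_harmonic R; rewrite -(cvg_shiftS (@harmonic R)).
have C1 : (fun i => s^-1 * (1 - e i `^ s)) @ \oo --> s^-1 * (1 - 0).
  by apply: cvgM; [exact: cvg_cst|apply: cvgB => //; exact: cvg_cst].
by move: C1; rewrite subr0 mulr1.
Qed.
End Beta.

Section Beta2.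
Variable R : realType.
Notation mu := (@lebesgue_measure R).
Notation RT := (measurableTypeR R).

Definition tpow (s t : R) : R := if t <= 1 then pws s t else 0.

Lemma integral_tpow (s : R) : 0 < s -> (\int[mu]_t (tpow s t)%:E = (s^-1)%:E)%E.
Proof.
move=> s0; rewrite -(integral_powR01 s0) [RHS]integral_mkcond; apply: eq_integral => t _ /=.
rewrite patchE mem_setE in_itv/= /tpow /pws.
by case: leP => t1; case: ltP => t0.
Qed.

Lemma integrable_tpow (s : R) : 0 < s -> mu.-integrable setT (EFin \o tpow s).
Proof.
move=> s0; apply/integrableP; split.
  apply/measurable_EFinP; apply: measurable_fun_ifT => //; first exact: measurable_fun_ler.
  exact: measurable_pws.
under eq_integral => t _.
  rewrite /= ger0_norm; last by rewrite /tpow; case: ifP => // _; exact: pws_ge0.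
  over.
by rewrite integral_tpow// ltry.
Qed.

Definition bint (a b c t : R) : R := pw a t * pws b (c - t).
Definition betaR (a b : R) : R := Rintegral mu setT (bint a b 1).

Lemma measurable_bint a b c : measurable_fun (setT : set RT) (bint a b c).
Proof.
apply: measurable_funM; first exact: measurable_pw.
by apply: (measurableT_comp (measurable_pws b)); exact: measurable_funB.
Qed.

Lemma bint_ge0 a b c t : 0 <= bint a b c t.
Proof. by rewrite mulr_ge0 ?pw_ge0 ?pws_ge0. Qed.

Lemma powR_half_le (a t : R) : 2^-1 <= t <= 1 -> t `^ (a - 1) <= 1 + 2^-1 `^ (a - 1).
Proof.
move=> /andP[t0 t1]; have h0 : 0 < t by lra.
have [a1|a1] := leP 0 (a - 1).
  apply: (@le_trans _ _ 1); last by rewrite lerDl powR_ge0.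
  have := @powR1 R => /(congr1 (fun f => f (a - 1))) {2}<-; apply: ge0_ler_powR; rewrite ?nnegrE; lra.
apply: (@le_trans _ _ (2^-1 `^ (a - 1))); last by rewrite lerDr.
rewrite -[a - 1]opprK !(powRN _ (- (a - 1))).
rewrite lef_pV2 ?posrE ?powR_gt0//.
by apply: ge0_ler_powR; rewrite ?nnegrE; lra.
Qed.

(** On each half of [0, 1] only one factor can be singular; the other lies in the range of
    [powR_half_le]. The dominating [g] adds the two resulting bounds. *)
Lemma integrable_bint1 (a b : R) : 0 < a -> 0 < b -> mu.-integrable setT (EFin \o bint a b 1).
Proof.
move=> a0 b0.
pose M (e : R) : R := 1 + 2^-1 `^ (e - 1).
have M0 e : 0 < M e by rewrite ltr_pwDl// powR_ge0.
pose g t := M b * tpow a t + M a * tpow b (- 1 * t + 1).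
have ib : mu.-integrable setT (EFin \o (fun t => tpow b (- 1 * t + 1))).
  by apply: (integrable_affine 1 (a := -1)) (integrable_tpow b0); lra.
have ig : mu.-integrable setT (EFin \o g).
  exact: (integrableD measurableT (integrableZl measurableT (M b) (integrable_tpow a0))
    (integrableZl measurableT (M a) ib)).
apply: le_integrable ig => //; first by apply/measurable_EFinP; exact: measurable_bint.
move=> t _; rewrite /= lee_fin ger0_norm ?bint_ge0//; apply: le_trans (ler_norm _).
have tp0 e u : 0 <= tpow e u by rewrite /tpow; case: ifP => // _; exact: pws_ge0.
rewrite /g /bint (_ : -1 * t + 1 = 1 - t); last lra.
have [tn|t0] := ltP t 0.
  by rewrite /pw (leNgt 0 t) tn/= mul0r addr_ge0// mulr_ge0// ltW.
have [t1|t1] := leP 1 t.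
  by rewrite /pws subr_gt0 (ltNge t 1) t1/= mulr0 addr_ge0// mulr_ge0// ltW.
rewrite /pw t0 /tpow /pws subr_gt0 t1 (ltW t1) (_ : 1 - t <= 1 = true); last by apply/idP; lra.
have [th|th] := leP (2^-1) t.
  rewrite -[leLHS]add0r; apply: lerD; first by apply: mulr_ge0; [exact: ltW|case: ifP => // _; exact: powR_ge0].
  by rewrite ler_wpM2r ?powR_ge0// powR_half_le//; lra.
have h : (1 - t) `^ (b - 1) <= M b by apply: powR_half_le; lra.
have [t00|tn0] := eqVneq t 0.
  rewrite t00 ltxx mulr0 add0r subr0 powR1 mulr1.
  have [->|?] := eqVneq (a - 1) 0; first by rewrite powRr0 /M mulr1 lerDl powR_ge0.
  by rewrite powR0// mulr_ge0// ltW.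
have tp : 0 < t by rewrite lt_neqAle eq_sym tn0.
rewrite tp -[leLHS]addr0; apply: lerD; last by rewrite mulr_ge0 ?powR_ge0// ltW.
by rewrite mulrC ler_wpM2r ?powR_ge0.
Qed.

Lemma bint_le0 a b c t : c <= 0 -> bint a b c t = 0.
Proof.
move=> c0; rewrite /bint /pw /pws; have [t0|t0] := leP 0 t; last by rewrite mul0r.
by rewrite ltNge (_ : c - t <= 0) ?mulr0//; lra.
Qed.

Lemma bint_scale a b c t : 0 < c -> bint a b c (c * t + 0) = c `^ (a - 1) * c `^ (b - 1) * bint a b 1 t.
Proof.
move=> c0; rewrite addr0 /bint (_ : c - c * t = c * (1 - t)); last by ring.
rewrite /pw /pws !pmulr_rge0// !pmulr_rgt0//.
case: ifP => t0; last by rewrite !(mul0r, mulr0).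
case: ifP => t1; last by rewrite !mulr0.
by rewrite !powRM ?(ltW c0)// ?(ltW t1)//; ring.
Qed.

Lemma integrable_bint a b c : 0 < a -> 0 < b -> mu.-integrable setT (EFin \o bint a b c).
Proof.
move=> a0 b0; have [c0|c0] := leP c 0.
  apply: (eq_integrable measurableT (cst 0%E)); last exact: integrable0.
  by move=> t _ /=; rewrite bint_le0.
have cn0 : c != 0 by rewrite gt_eqF.
have ci0 : c^-1 != 0 by rewrite invr_eq0.
have := integrable_affine 0 ci0 (integrable_bint1 a0 b0).
move=> /(integrableZl measurableT (c `^ (a - 1) * c `^ (b - 1))).
apply: eq_integrable => // t _ /=; rewrite -EFinM; congr EFin.
by rewrite -bint_scale// !addr0 mulVKf.
Qed.

(** The substitution t = c u produces c^(a-1) c^(b-1) c = c^(a+b-1). The result is again a power of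
    the available mass [c], so Dirichlet weights can be integrated one coordinate at a time. *)
Lemma Rintegral_bint a b c : 0 < a -> 0 < b ->
  Rintegral mu setT (bint a b c) = betaR a b * pws (a + b) c.
Proof.
move=> a0 b0; have [c0|c0] := leP c 0.
  rewrite (@eq_Rintegral _ _ _ _ _ (cst 0)); last by move=> t _; exact: bint_le0.
  by rewrite Rintegral_cst// mul0r /pws (ltNge 0 c) c0/= mulr0.
have cn0 : c != 0 by rewrite gt_eqF.
rewrite (Rintegral_affine 0 cn0 (measurable_bint _ _ _)).
under eq_Rintegral => t _ do rewrite bint_scale//.
rewrite RintegralZl//; last exact: integrable_bint1.
rewrite /pws c0 gtr0_norm// /betaR mulrA [RHS]mulrC; congr (_ * _).
rewrite mulrA mulr_powRB1// ?(ltW c0)// -powRD; last by rewrite cn0 implybT.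
by congr (_ `^ _); ring.
Qed.

(** On [1/4, 1/2] both t and 1 - t lie in [1/4, 1], where u^e >= (1/4)^|e| for exponents of either
    sign; this bounds the integrand below on a set of measure 1/4. *)
Lemma betaR_gt0 a b : 0 < a -> 0 < b -> 0 < betaR a b.
Proof.
move=> a0 b0.
have low (u e : R) : 4^-1 <= u <= 1 -> 4^-1 `^ `|e| <= u `^ e.
  move=> /andP[u0 u1]; apply: (@le_trans _ _ (u `^ `|e|)).
    by apply: ge0_ler_powR; rewrite ?nnegrE //; lra.
  by apply: ger_powR; [lra|exact: ler_norm].
pose m : R := 4^-1 `^ `|a - 1| * 4^-1 `^ `|b - 1|.
have m0 : 0 < m by rewrite mulr_gt0// powR_gt0.
pose D : set R := `[4^-1, 2^-1]%classic.
have mD : measurable (D : set RT) by exact: measurable_itv.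
have muD : mu D = (4^-1)%:E.
  have h : 4^-1 < 2^-1 :> R by lra.
  rewrite lebesgue_measure_itv/= lte_fin h -EFinB; congr (_%:E); lra.
have i1 : mu.-integrable (setT : set RT) (EFin \o \1_D).
  exact: (integrable_indic_itv 4^-1 2^-1 true false).
have iD : mu.-integrable (setT : set RT) (EFin \o (fun t => m * \1_D t)).
  exact: (integrableZl measurableT m i1).
have muD0 : 0 < fine (mu D) by rewrite muD /=; lra.
apply: (@lt_le_trans _ _ (Rintegral mu setT (fun t => m * \1_D t))).
  rewrite RintegralZl//.
  by rewrite mulr_gt0// /Rintegral integral_indic// setIT.
apply: le_Rintegral => //; first exact: integrable_bint1.
move=> t _; rewrite indicE; case: (boolP (t \in D)) => [|_]; last by rewrite mulr0 bint_ge0.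
rewrite inE /D /= in_itv/= mulr1 => /andP[t0 t1].
rewrite /bint /pw /pws !ifT; [|lra|lra].
by apply: ler_pM; rewrite ?powR_ge0//; apply: low; lra.
Qed.
End Beta2.

(** * Recursive Dirichlet weights and exchange of integration variables *)

Section Rotation.
Variable R : realType.
Notation mu := (@lebesgue_measure R).
Notation RT := (measurableTypeR R).
Implicit Types (a s : seq R) (G : seq R -> R).

(** [f] is [g] plus a multiple of the indicator of [c, c], a null set. This absorbs the different
    boundary conventions of [pw] and [pws]. *)
Lemma integrable_off_point (f g : R -> R) (c : R) : (forall t, t != c -> f t = g t) ->
  mu.-integrable setT (EFin \o g) ->
  mu.-integrable setT (EFin \o f) /\ Rintegral mu setT f = Rintegral mu setT g.
Proof.
move=> fg ig; pose D : set R := `[c, c]%classic.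
have iD : mu.-integrable setT (EFin \o \1_D) by exact: (integrable_indic_itv c c true false).
have iD' : mu.-integrable setT (EFin \o (fun t => (f c - g c) * \1_D t)).
  exact: (integrableZl measurableT (f c - g c) iD).
have fE : f = (fun t => g t + (f c - g c) * \1_D t).
  apply/funext => t; rewrite indicE; have [->|tc] := eqVneq t c.
    by rewrite mem_set /D /= ?in_itv/= ?lexx// mulr1 addrC subrK.
  rewrite memNset ?mulr0 ?addr0 ?fg//= /D /= in_itv/= => /andP[h1 h2].
  by move/negP: tc; apply; rewrite eq_le h1 h2.
split; first by rewrite fE; exact: (integrableD measurableT ig iD').
rewrite {1}fE RintegralD// RintegralZl// [X in _ * X](_ : _ = 0) ?mulr0 ?addr0//.
rewrite /Rintegral integral_indic ?setIT//; last exact: measurable_itv.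
have : fine (mu D) = 0 by rewrite lebesgue_measure_itv/= ltxx.
exact.
Qed.

(** The unnormalised Dirichlet density on a simplex of total mass [c]: parameters [a] for the listed
    coordinates, [b] for the coordinate receiving the mass left over. *)
Fixpoint Wrec a (b c : R) s : R :=
  match a, s with
  | a1 :: a', t :: s' => pw a1 t * Wrec a' b (c - t) s'
  | _, _ => pw b c
  end.

(** The stick-breaking form of the Dirichlet normaliser, a product of Beta integrals. *)
Fixpoint Zrec a (b : R) : R :=
  if a is a1 :: a' then betaR a1 (\sum_(x <- a') x + b) * Zrec a' b else 1.

Notation gt0s := (all (fun x => 0 < x)).

Lemma sum_gt0s a (b : R) : gt0s a -> 0 < b -> 0 < \sum_(x <- a) x + b.
Proof.
move=> a0 b0; apply: ltr_wpDl => //; elim: a a0 => [|x a IH] /=; rewrite ?big_nil ?big_cons//.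
by move=> /andP[x0 a0]; rewrite addr_ge0 ?(ltW x0)// IH.
Qed.

Lemma Zrec_gt0 a b : gt0s a -> 0 < b -> 0 < Zrec a b.
Proof.
move=> + b0; elim: a => [//|x a IH] /= /andP[x0 a0].
by rewrite mulr_gt0 ?IH// betaR_gt0// sum_gt0s.
Qed.

Lemma Wrec_ge0 a b c s : 0 <= Wrec a b c s.
Proof. by elim: a c s => [|x a IH] c [|t s] /=; rewrite ?mulr_ge0 ?pw_ge0. Qed.

(** Induction on [a] with the mass [c] varying, by [Rintegral_bint]. The value formula excludes c =
    0, where [pw] and [pws] may differ; in the next integral this concerns the single point t =
    c. *)
Lemma hered_Wrec a b c : gt0s a -> 0 < b -> hered (size a) (Wrec a b c) /\
  (c != 0 -> iint (size a) (Wrec a b c) = Zrec a b * pws (\sum_(x <- a) x + b) c).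
Proof.
move=> + b0; elim: a c => [|x a IH] c /=.
  by move=> _; split=> // c0; rewrite big_nil add0r mul1r pw_pws.
move=> /andP[x0 a0].
have sa := sum_gt0s a0 b0.
have hS t := heredZ (pw x t) (IH (c - t) a0).1.
set f := fun t : R => _.
have ig : mu.-integrable setT (EFin \o (fun t => Zrec a b * bint x (\sum_(i <- a) i + b) c t)).
  exact: (integrableZl measurableT (Zrec a b) (integrable_bint c x0 sa)).
have [|fi fI] := @integrable_off_point f (fun t => Zrec a b * bint x (\sum_(i <- a) i + b) c t) c _ ig.
  move=> t tc; rewrite /f (hS t).2 (IH (c - t) a0).2 ?subr_eq0 1?eq_sym// /bint; ring.
split; first by split=> // t; case: (hS t).
move=> c0; rewrite fI RintegralZl//; last exact: integrable_bint.
by rewrite Rintegral_bint// big_cons addrA; ring.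
Qed.

Lemma Wrec_swap x y a b c t u s :
  Wrec (x :: y :: a) b c (t :: u :: s) = Wrec (y :: x :: a) b c (u :: t :: s).
Proof. by rewrite /= (_ : c - t - u = c - u - t); ring. Qed.

Lemma Wrec_rcons a x b c s t : size a = size s ->
  Wrec (rcons a x) b c (rcons s t) = Wrec (x :: a) b c (t :: s).
Proof.
elim: a s c => [|y a IH] [|u s] c //= [sa].
by rewrite IH//= (_ : c - u - t = c - t - u); ring.
Qed.

(** The last listed coordinate and the leftover mass play symmetric roles: exchanging them exchanges
    their parameters. *)
Lemma Wrec_refl a x b c s t : size a = size s ->
  Wrec (rcons a x) b c (rcons s t) = Wrec (rcons a b) x c (rcons s (c - \sum_(u <- s) u - t)).
Proof.
elim: a s c => [|y a IH] [|u s] c //=.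
  by rewrite big_nil subr0 subKr mulrC.
move=> -[sa]; by rewrite IH// big_cons; congr (_ * Wrec _ _ _ (rcons _ _)); ring.
Qed.

(** The parameters of the dominating weight are existential, so the class is stable under permuting
    coordinates and, for c = 1, under reflecting one into the leftover mass; both operations merely
    permute the parameters. *)
Definition tame k (c : R) G := smeas k G /\ exists C a b,
  [/\ size a = k, gt0s a, 0 < b & forall s, size s = k -> `|G s| <= C * Wrec a b c s].

Lemma tame_hered k c G : tame k c G -> hered k G.
Proof.
move=> [mG [C [a [b [sa a0 b0 GW]]]]]; have hW := hered_Wrec c a0 b0.
by move: hW; rewrite sa => -[hW _]; exact: (hered_dom mG (heredZ C hW).1 GW).
Qed.

Lemma iint_ge0 k G : (forall s, 0 <= G s) -> 0 <= iint k G.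
Proof.
elim: k G => [|k IH] G G0 /=; first exact: G0.
by apply: (@Rintegral_ge0 _ _ _ mu) => t _; apply: IH => s; exact: G0.
Qed.

Lemma ler_norm_iint k G : hered k G -> hered k (fun s => `|G s|) ->
  `|iint k G| <= iint k (fun s => `|G s|).
Proof.
move=> hG hN; have [hM iM] := heredZ (-1) hN.
rewrite ler_norml -mulN1r -iM; apply/andP; split; apply: iint_le => // s _.
  by rewrite mulN1r lerNl -normrN ler_norm.
exact: ler_norm.
Qed.

Lemma smeas_norm k G : smeas k G -> smeas k (fun s => `|G s|).
Proof. by move=> mG; exact: measurableT_comp. Qed.

Lemma tame_norm k c G : tame k c G -> tame k c (fun s => `|G s|).
Proof.
move=> [mG [C [a [b [sa a0 b0 GW]]]]]; split; first exact: smeas_norm.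
by exists C, a, b; split=> // s sk; rewrite normr_id; exact: GW.
Qed.

Lemma smeas_nth k i : smeas k (fun s => nth 0 s i : R).
Proof.
have [ik|ki] := ltnP i k.
  rewrite /smeas (_ : (fun t : k.-tuple RT => _) = (fun t => tnth t (Ordinal ik))).
    exact: measurable_tnth.
  by apply/funext => t; rewrite (tnth_nth 0).
rewrite /smeas (_ : (fun t : k.-tuple RT => _) = cst 0); first exact: measurable_cst.
by apply/funext => t /=; rewrite nth_default// size_tuple.
Qed.

Lemma smeas_sum k : smeas k (fun s => \sum_(t <- s) t : R).
Proof.
rewrite /smeas (_ : (fun t : k.-tuple RT => _) = (fun t => \sum_(i < k) nth 0 t i)).
  by apply: measurable_sum => i; exact: smeas_nth.
by apply/funext => t /=; rewrite big_tuple; apply: eq_bigr => i _; rewrite (tnth_nth 0).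
Qed.

Lemma smeas_comp k l G (phi : seq R -> seq R) : smeas l G ->
  (forall s, size s = k -> size (phi s) = l) ->
  (forall i, (i < l)%N -> smeas k (fun s => nth 0 (phi s) i)) ->
  smeas k (fun s => G (phi s)).
Proof.
move=> mG sphi mphi.
have sz (t : k.-tuple RT) : size (phi t) == l by rewrite sphi ?size_tuple.
apply: (measurableT_comp mG (g := fun t : k.-tuple RT => Tuple (sz t))).
apply/measurable_fun_tnthP => i.
rewrite (_ : _ \o _ = (fun t : k.-tuple RT => nth 0 (phi t) i)); first exact: mphi.
by apply/funext => t /=; rewrite (tnth_nth 0).
Qed.

Lemma tame_cons k c G t : tame k.+1 c G -> tame k (c - t) (fun s => G (t :: s)).
Proof.
move=> [mG [C [a' [b [sa a0' b0 GW]]]]]; split; first exact: smeas_cons.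
case: a' sa a0' GW => [//|x a] [sa] /andP[x0 a0] GW.
exists (C * pw x t), a, b; split=> // s sk.
by rewrite -mulrA; apply: (GW (t :: s)); rewrite /= sk.
Qed.

Definition swap2 s := if s is x :: y :: r then y :: x :: r else s.

Lemma size_swap2 s : size (swap2 s) = size s.
Proof. by case: s => [|x [|y s]]. Qed.

Lemma nth_swap2 (s : seq R) i : (1 < size s)%N ->
  nth 0 (swap2 s) i = nth 0 s (if i == 0%N then 1%N else if i == 1%N then 0%N else i).
Proof. by case: s => [|x [|y s]] //; case: i => [|[|i]]. Qed.

Lemma smeas_swap2 k G : smeas k.+2 G -> smeas k.+2 (fun s => G (swap2 s)).
Proof.
move=> mG; apply: (smeas_comp mG) => [s <-|i ik]; first exact: size_swap2.
rewrite /smeas (_ : (fun t : k.+2.-tuple RT => _) =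
  (fun t => nth 0 t (if i == 0%N then 1%N else if i == 1%N then 0%N else i))).
  exact: smeas_nth.
by apply/funext => t; rewrite nth_swap2 ?size_tuple.
Qed.

Lemma tame_swap2 k c G : tame k.+2 c G -> tame k.+2 c (fun s => G (swap2 s)).
Proof.
move=> [mG [C [a [b [sa a0 b0 GW]]]]]; split; first exact: smeas_swap2.
case: a sa a0 GW => [|x [|y a]] //= [sa] /and3P[x0 y0 a0] GW.
exists C, [:: y, x & a], b; split; [by rewrite /= sa|by apply/and3P|by []|].
move=> [|t [|u s]] // su; rewrite -Wrec_swap; exact: GW.
Qed.

(** Fubini for the two outer variables, applied to the inner [k]-fold integral [f]. Its
    integrability on the product comes from the iterated integral of |G|, finite because |G| is tame
    too. *)
Lemma iint_swap2 k c G : tame k.+2 c G ->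
  iint k.+2 (fun s => G (swap2 s)) = iint k.+2 G.
Proof.
move=> tG; have [hG iG] := tame_hered tG.
have [hS iS] := tame_hered (tame_swap2 tG).
have [hN iN] := tame_hered (tame_norm tG).
pose f (z : RT * RT) : \bar R := (iint k (fun s => G (z.1 :: z.2 :: s)))%:E.
have mf : measurable_fun setT f.
  apply/measurable_EFinP.
  apply: (@measurable_iint_param _ k _ _ (fun z : RT * RT => fun s => G (z.1 :: z.2 :: s))).
  apply: (measurableT_comp tG.1 (g := fun z : RT * RT * k.-tuple RT =>
     [the k.+2.-tuple RT of z.1.1 :: [the k.+1.-tuple RT of z.1.2 :: z.2]])).
  apply: measurable_cons; first exact: measurableT_comp.
  by apply: measurable_cons => //; exact: measurableT_comp.
(* Integrability makes the extended-real inner integral finite, so nothing is lost in passing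
   through [fine]. *)
have fin2 (F : seq R -> R) : (forall t, hered k.+1 (fun s => F (t :: s))) -> forall t,
    (\int[mu]_u (iint k (fun s => F (t :: u :: s)))%:E)%E = (iint k.+1 (fun s => F (t :: s)))%:E.
  move=> hF t; rewrite /= /Rintegral fineK//; exact: integrable_fin_num (hF t).2.
have If : (mu \x mu)%E.-integrable setT f.
  apply/integrable12ltyP => //.
  apply: (@le_lt_trans _ _ (\int[mu]_t (iint k.+1 (fun s => `|G (t :: s)|))%:E)%E).
    apply: ge0_le_integral => //.
    - by move=> t _; exact: integral_ge0.
    - apply: (@measurable_fun_fubini_tonelli_F _ _ RT RT _ mu (abse \o f)).
        exact: measurableT_comp.
      by move=> z; exact: abse_ge0.
    - by case/integrableP: iN.
    - move=> t _; rewrite -(fin2 (fun s => `|G s|) hN t).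
      have [hNt iNt] := hN t; have [hGt _] := hG t.
      apply: ge0_le_integral => //.
      + have mt : measurable_fun setT (fun u : RT => (t : RT, u)) by exact: measurable_fun_pair.
        have ma : measurable_fun setT (abse \o f) by exact: measurableT_comp.
        exact: (measurableT_comp ma mt).
      + by case/integrableP: iNt.
      + move=> u _; rewrite lee_fin; exact: (ler_norm_iint (hGt u) (hNt u)).
  have /fin_numP := integrable_fin_num measurableT iN.
  rewrite /= ltey => -[_ ->] //.
have E1 : iint k.+2 G = fine (\int[mu]_t \int[mu]_u f (t, u))%E.
  by congr fine; apply: eq_integral => t _; rewrite /f fin2.
have E2 : iint k.+2 (fun s => G (swap2 s)) = fine (\int[mu]_u \int[mu]_t f (t, u))%E.
  congr fine; apply: eq_integral => t _.
  by rewrite -(fin2 (fun s => G (swap2 s))).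
by rewrite E1 E2 (Fubini If).
Qed.

End Rotation.

(** * Measurability and boundedness of continuous functions of a vector *)

Section ContinuousMeasurable.
Variable R : realType.
Notation RT := (measurableTypeR R).

(** An open set is the union of the countably many cubes with rational centre and radius 1/(k+1)
    that it contains; the preimage of a cube is a finite intersection of coordinate conditions. *)
Lemma measurable_preimage_open_rV d (T : measurableType d) n (phi : T -> 'rV[R]_n) (U : set 'rV[R]_n) :
  (forall i, measurable_fun setT (fun t => phi t 0 i : RT)) -> open U ->
  measurable (phi @^-1` U).
Proof.
move=> mphi oU.
pose B (qk : 'rV[rat]_n * nat) := [set z : 'rV[R]_n | forall i, `|ratr (qk.1 0 i) - z 0 i| < qk.2.+1%:R^-1].
have mB qk : measurable (phi @^-1` B qk).
  rewrite (_ : _ @^-1` _ = \bigcap_(i in [set: 'I_n])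
     ((fun t => `|ratr (qk.1 0 i) - phi t 0 i| : RT) @^-1` `]-oo, qk.2.+1%:R^-1[)).
    apply: fin_bigcap_measurable => [|i _]; first exact: finite_finset.
    rewrite -[X in measurable X]setTI.
    have : measurable_fun setT (fun t => `|ratr (qk.1 0 i) - phi t 0 i| : RT).
      by apply: measurableT_comp => //; apply: measurable_funB => //; exact: mphi.
    by apply=> //; exact: measurable_itv.
  apply/seteqP; split=> t /=.
    by move=> h i _ /=; rewrite in_itv/=; exact: h.
  by move=> h i; have := h i I; rewrite /= in_itv.
pose F j := if unpickle j is Some qk then
   (if `[< B qk `<=` U >] then phi @^-1` B qk else set0) else set0.
rewrite (_ : phi @^-1` U = \bigcup_j F j).
  apply: bigcupT_measurable => j; rewrite /F; case: unpickle => // qk.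
  by case: asboolP => // _; exact: mB.
apply/seteqP; split=> t /=; last first.
  by move=> [j _]; rewrite /F; case: unpickle => // qk; case: asboolP => // BU /BU.
move=> Ut; have /nbhs_ballP[e /= e0 eU] : nbhs (phi t) U by exact: open_nbhs_nbhs.
(* Radius below e/2: a cube whose centre is that close to [phi t] stays in the ball of radius e
   around [phi t]. *)
have [k] := ltr_add_invr (divr_gt0 e0 (ltr0n R 2)); rewrite add0r => ke.
have qE i : {q : rat | `|ratr q - phi t 0 i| < k.+1%:R^-1}.
  apply: cid; have h : phi t 0 i - k.+1%:R^-1 < phi t 0 i + k.+1%:R^-1.
    by rewrite ltrBlDr -addrA ltrDl addr_gt0.
  have [q] := rat_in_itvoo h; rewrite in_itv/= => hq; exists q.
  by rewrite ltr_distl.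
pose q : 'rV[rat]_n := \row_i sval (qE i).
exists (pickle (q, k)) => //; rewrite /F pickleK asboolT.
  by move=> i /=; rewrite mxE; case: (qE i).
move=> z Bz; apply: eU; split=> // i j; rewrite (ord1 i).
have h1 := Bz j; have h2 : `|ratr (q 0 j) - phi t 0 j| < k.+1%:R^-1 by rewrite mxE; case: (qE j).
rewrite /= in h1 h2 *; rewrite /ball/= (_ : phi t 0 j - z 0 j =
  (ratr (q 0 j) - z 0 j) - (ratr (q 0 j) - phi t 0 j)); last by ring.
apply: le_lt_trans (ler_normB _ _) _; apply: lt_trans (ltrD h1 h2) _.
move: ke; set k1 := _^-1 => ke; lra.
Qed.

Lemma measurable_continuous_rV d (T : measurableType d) n (phi : T -> 'rV[R]_n) (g : 'rV[R]_n -> R) :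
  (forall i, measurable_fun setT (fun t => phi t 0 i : RT)) -> continuous g ->
  measurable_fun setT (fun t => g (phi t) : RT).
Proof.
move=> mphi /continuousP cg; apply: (measurability _ (RGenOpens.measurableE R)).
move=> _ [_ [a [b ->] <-]]; rewrite setTI.
have oU : open (g @^-1` `]a, b[) by apply: cg; exact: interval_open.
exact: (measurable_preimage_open_rV mphi oU).
Qed.

Lemma continuous_bounded_box n (g : 'rV[R]_n -> R) : continuous g ->
  exists2 C : R, 0 < C & forall v : 'rV[R]_n, (forall i, 0 <= v 0 i <= 1) -> `|g v| <= C.
Proof.
move=> cg.
have cK : compact [set v : 'rV[R]_n | forall i, v ord0 i \in `[0%R, 1%R]].
  by apply: (@rV_compact R n (fun=> `[(0 : R), (1 : R)]%classic)) => _; exact: segment_compact.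
have := continuous_compact (continuous_subspaceT cg) cK.
move=> /compact_bounded[M [_ hM]]; exists (Num.max 0 M + 1); first by rewrite ltr_wpDl// le_max lexx.
move=> v hv; apply: (hM (Num.max 0 M + 1)); first by rewrite ltr_pwDr// le_max lexx orbT.
by exists v => //= i; rewrite in_itv/=.
Qed.
End ContinuousMeasurable.

(** * Cyclic invariance of Dirichlet integrals *)

Section DirichletRotation.
Variable R : realType.
Notation mu := (@lebesgue_measure R).
Notation RT := (measurableTypeR R).
Notation gt0s := (all (fun x : R => 0 < x)).
Implicit Types (a s : seq R) (G : seq R -> R).

Lemma smeas_take_last k : (forall i, (i < k.+1)%N ->
  smeas k.+1 (fun s : seq R => nth 0 (rcons (take (size s).-1 s) (1 - \sum_(t <- s) t)) i)).
Proof.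
move=> i; rewrite ltnS leq_eqVlt => /orP[/eqP ->|ik].
  rewrite /smeas (_ : (fun t : k.+1.-tuple RT => _) = (fun t => 1 - \sum_(x <- t) x)).
    by apply: measurable_funB => //; exact: smeas_sum.
  by apply/funext => t; rewrite nth_rcons size_take size_tuple ltnSn ltnn eqxx.
rewrite /smeas (_ : (fun t : k.+1.-tuple RT => _) = (fun t => nth 0 t i)); first exact: smeas_nth.
by apply/funext => t; rewrite nth_rcons size_take size_tuple ltnSn ik nth_take.
Qed.

Lemma smeas_rot1 k G : smeas k.+1 G -> smeas k.+1 (fun s => G (rot 1 s)).
Proof.
move=> mG; apply: (smeas_comp mG) => [s <-|i ik]; first exact: size_rot.
rewrite /smeas (_ : (fun t : k.+1.-tuple RT => _) = (fun t => nth 0 t (if i == k then 0%N else i.+1))).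
  exact: smeas_nth.
apply/funext => -[[//|x t] /= /eqP[st]]; rewrite rot1_cons nth_rcons st.
by case: (ltngtP i k) ik => // ki _; rewrite /= nth_default// st ltnW.
Qed.

Lemma tame_rot1 k c G : tame k.+1 c G -> tame k.+1 c (fun s => G (rot 1 s)).
Proof.
move=> [mG [C [a [b [sa a0 b0 GW]]]]]; split; first exact: smeas_rot1.
case/lastP: a sa a0 GW => [//|a x]; rewrite size_rcons => -[sa].
rewrite all_rcons => /andP[x0 a0] GW.
exists C, (x :: a), b; split; [by rewrite /= sa|by apply/andP|by []|].
move=> [//|t s] /= [sk]; have := GW (rcons s t).
rewrite size_rcons sk => /(_ erefl); rewrite Wrec_rcons ?sa ?sk//.
by rewrite rot1_cons.
Qed.

(** [rot 1 (swap2 (t :: u :: s))] is [t :: rot 1 (u :: s)], so one exchange of the outer variables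
    reduces to the induction hypothesis under the first integral. *)
Lemma iint_rot1 k c G : tame k.+1 c G -> iint k.+1 (fun s => G (rot 1 s)) = iint k.+1 G.
Proof.
elim: k c G => [|k IH] c G tG; first by apply: iint_ext => -[//|t []].
have tK := tame_rot1 tG.
rewrite -(iint_swap2 tK).
change (Rintegral mu setT (fun t => iint k.+1 (fun s => G (rot 1 (swap2 (t :: s))))) =
  Rintegral mu setT (fun t => iint k.+1 (fun s => G (t :: s)))).
apply: eq_Rintegral => t _.
rewrite -[RHS](IH _ _ (tame_cons t tG)); apply: (@iint_ext _ k.+1) => -[//|u s] _ /=.
by rewrite !rot1_cons.
Qed.

Lemma iint_last k G : iint k.+1 G = iint k (fun s => Rintegral mu setT (fun t => G (rcons s t))).
Proof. by elim: k G => [//|k IH] G; apply: eq_Rintegral => t _; exact: (IH (fun s => G (t :: s))). Qed.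

Lemma take_size_rcons s (t : R) : take (size s) (rcons s t) = s.
Proof. by rewrite -cats1 takel_cat// take_size. Qed.

Lemma sum_rcons s (t : R) : \sum_(x <- rcons s t) x = \sum_(x <- s) x + t.
Proof. by rewrite -cats1 big_cat big_seq1. Qed.

(** The cyclic shift of (lambda_1, ..., lambda_n) in the chart that omits lambda_1: the old lambda_1
    goes last, and the head dropped from [s] becomes the new dependent coordinate. *)
Definition rotS s := rcons (behead s) (1 - \sum_(t <- s) t).

(** [rotS] is [rot 1] followed by the reflection t -> 1 - sum - t of the last coordinate, an affine
    map of slope -1 in the innermost integral. *)
Lemma iint_rotS k G : tame k.+1 1 G -> iint k.+1 (fun s => G (rotS s)) = iint k.+1 G.
Proof.
move=> [mG [C [a [b [sa a0 b0 GW]]]]].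
pose G2 s := G (rcons (take (size s).-1 s) (1 - \sum_(t <- s) t)).
have tG2 : tame k.+1 1 G2.
  split.
    apply: (smeas_comp mG) => [s sk|i ik]; last exact: smeas_take_last.
    by rewrite size_rcons size_take sk ltnSn.
  case/lastP: a sa a0 GW => [//|a x]; rewrite size_rcons => -[sa].
  rewrite all_rcons => /andP[x0 a0] GW.
  exists C, (rcons a b), x; split=> //; [by rewrite size_rcons sa|by rewrite all_rcons b0|].
  move=> s; case/lastP: s => [//|s t]; rewrite size_rcons => -[sk].
  rewrite /G2 size_rcons /= take_size_rcons sum_rcons Wrec_refl ?size_rcons ?sa ?sk//.
  by have := GW (rcons s (1 - \sum_(u <- s) u - t)); rewrite opprD addrA; apply; rewrite size_rcons sk.
transitivity (iint k.+1 (fun s => G2 (rot 1 s))).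
  apply: iint_ext => -[//|t s] _; rewrite /G2 /rotS rot1_cons size_rcons /=.
  by rewrite take_size_rcons sum_rcons big_cons [t + _]addrC.
rewrite (iint_rot1 tG2) !iint_last; apply: iint_ext => s sk.
have mGs : measurable_fun (setT : set RT) (fun t => G (rcons s t)).
  have sz (t : RT) : size (rcons s t) == k.+1 by rewrite size_rcons sk.
  apply: (measurableT_comp mG (g := fun t : RT => Tuple (sz t))).
  apply/measurable_fun_tnthP => i; rewrite (_ : _ \o _ = fun t : RT => nth 0 (rcons s t) i).
    have [ik|ki] := ltnP i k.
      rewrite (_ : (fun t => _) = cst (nth 0 s i)); first exact: measurable_cst.
      by apply/funext => t; rewrite nth_rcons sk ik.
    rewrite (_ : (fun t => _) = id); first exact: measurable_id.
    apply/funext => t; rewrite nth_rcons sk ltnNge ki /=.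
    by rewrite ifT// eqn_leq ki -ltnS ltn_ord.
  by apply/funext => t /=; rewrite (tnth_nth 0).
have m10 : -1 != 0 :> R by rewrite oppr_eq0 oner_eq0.
rewrite (Rintegral_affine (1 - \sum_(u <- s) u) m10 mGs) normrN1 mul1r.
apply: eq_Rintegral => t _; rewrite /G2 size_rcons /= take_size_rcons sum_rcons.
by congr (G (rcons _ _)); ring.
Qed.

Lemma prod_eq0_lt (n : nat) (g : 'I_n -> R) (b : 'I_n -> R) i : g i < 0 ->
  \prod_(k < n) pw (b k) (g k) = 0.
Proof. by move=> gi; apply/eqP; rewrite prodf_seq_eq0; apply/hasP; exists i; rewrite ?mem_index_enum//= /pw leNgt gi. Qed.

(** A negative coordinate kills its [pw] factor, so the product already contains the simplex
    test. *)
Lemma dir_w_prod K (beta : 'I_K.+1 -> R) s : size s = K ->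
  dir_w beta s = \prod_(k < K.+1) pw (beta k) (lamN s k).
Proof.
move=> sK; rewrite /dir_w; case: ifPn => [/andP[/all_nthP s0 t0]|].
  apply: eq_bigr => -[[|k] kK] _; rewrite /pw /= ?t0//.
  by rewrite s0// sK.
rewrite negb_and => /orP[|t0].
  rewrite -has_predC => /(has_nthP 0)[i isz /=]; rewrite -ltNge => si.
  have iK : (i.+1 < K.+1)%N by rewrite ltnS -sK.
  by rewrite (@prod_eq0_lt _ _ _ (Ordinal iK)).
by rewrite (@prod_eq0_lt _ _ _ ord0)//= ltNge.
Qed.

(** [beta ord0] is left out because coordinate 0 is the dependent one; it plays the role of [b] in
    [Wrec]. *)
Definition avec K (beta : 'I_K.+1 -> R) := [seq beta (lift ord0 i) | i <- enum 'I_K].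

Lemma size_avec K (beta : 'I_K.+1 -> R) : size (avec beta) = K.
Proof. by rewrite size_map size_enum_ord. Qed.

Lemma sum_avec K (beta : 'I_K.+1 -> R) : \sum_(x <- avec beta) x + beta ord0 = \sum_k beta k.
Proof. by rewrite big_map big_enum /= big_ord_recl addrC. Qed.

Lemma avec_gt0 K (beta : 'I_K.+1 -> R) : (forall k, 0 < beta k) -> gt0s (avec beta).
Proof. by move=> b0; apply/allP => _ /mapP[i _ ->]. Qed.

Lemma Wrec_prod a b c s : size a = size s ->
  Wrec a b c s = (\prod_(i < size s) pw (nth 0 a i) (nth 0 s i)) * pw b (c - \sum_(t <- s) t).
Proof.
elim: a s c => [|x a IH] [|t s] c //=; first by rewrite big_ord0 mul1r big_nil subr0.
by move=> [sa]; rewrite IH// big_ord_recl /= big_cons opprD addrA mulrA.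
Qed.

Lemma dir_w_Wrec K (beta : 'I_K.+1 -> R) s : size s = K ->
  dir_w beta s = Wrec (avec beta) (beta ord0) 1 s.
Proof.
move=> sK; rewrite dir_w_prod// Wrec_prod ?size_avec// big_ord_recl mulrC; congr (_ * _).
move: sK => <- in beta *; apply: eq_bigr => i _; congr (pw _ _).
by rewrite (nth_map i) ?size_enum_ord// nth_ord_enum.
Qed.

Lemma dir_w_ge0 n (beta : 'I_n -> R) s : 0 <= dir_w beta s.
Proof. by rewrite /dir_w; case: ifP => // _; apply: prodr_ge0 => k _; exact: powR_ge0. Qed.

Lemma smeas_lamN K k : smeas K (fun s => lamN s k : R).
Proof.
case: k => [|k] /=; last exact: smeas_nth.
by apply: measurable_funB => //; exact: smeas_sum.
Qed.

Lemma smeas_dir_w K (beta : 'I_K.+1 -> R) : smeas K (dir_w beta).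
Proof.
rewrite /smeas (_ : (fun t : K.-tuple RT => _) = (fun t : K.-tuple RT => \prod_(k < K.+1) pw (beta k) (lamN t k))).
  apply: measurable_prod => k _.
  by apply: (measurableT_comp (measurable_pw (beta k))); exact: smeas_lamN.
by apply/funext => t; rewrite dir_w_prod ?size_tuple.
Qed.

Definition contF n (F : ('I_n -> R) -> R) := continuous (fun v : 'rV[R]_n => F (fun k => v 0 k)).

Lemma lamN_sum K s : size s = K -> \sum_(k < K.+1) lamN s k = 1 :> R.
Proof.
move=> <-; rewrite big_ord_recl /= (big_nth 0) big_mkord.
by under [X in _ + X]eq_bigr => i _ do rewrite /=; rewrite subrK.
Qed.

Lemma contF_row n (F : ('I_n -> R) -> R) (lam : 'I_n -> R) :
  F lam = (fun v : 'rV[R]_n => F (fun k => v 0 k)) (\row_k lam k).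
Proof. by congr F; apply/funext => k; rewrite mxE. Qed.

(** The weight vanishes off the simplex, which lies in the unit cube, where the continuous [F] is
    bounded. *)
Lemma tame_dir K (beta : 'I_K.+1 -> R) (F : ('I_K.+1 -> R) -> R) :
  (forall k, 0 < beta k) -> contF F ->
  tame K 1 (fun s => dir_w beta s * F (fun k => lamN s k)).
Proof.
move=> b0 cF; split.
  apply: measurable_funM; first exact: smeas_dir_w.
  rewrite (_ : (fun t : K.-tuple RT => F _) =
      (fun t : K.-tuple RT => (fun v : 'rV[R]_K.+1 => F (fun k => v 0 k)) (\row_k lamN t k))).
    apply: (@measurable_continuous_rV R _ (K.-tuple RT) K.+1 (fun t => \row_k lamN t k) _ _ cF).
    by move=> i; under eq_fun do rewrite mxE; exact: smeas_lamN.
  by apply/funext => t; rewrite contF_row.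
have [C C0 hC] := continuous_bounded_box cF.
exists C, (avec beta), (beta ord0); split; [exact: size_avec|exact: avec_gt0|by []|].
move=> s sK; rewrite -dir_w_Wrec// normrM ger0_norm ?dir_w_ge0// mulrC.
rewrite /dir_w; case: ifPn => [/andP[/all_nthP s0 t0]|_]; last by rewrite !mulr0.
apply: ler_wpM2r; first by apply: prodr_ge0 => k _; exact: powR_ge0.
rewrite contF_row; apply: hC => i; rewrite mxE.
have l0 (k : 'I_K.+1) : 0 <= lamN s k by case: k => -[|k] kK //=; rewrite s0// sK.
rewrite l0 /= -(lamN_sum sK) (bigD1 i)//= lerDl; exact: sumr_ge0.
Qed.

Lemma iint_dir_w K (beta : 'I_K.+1 -> R) : (forall k, 0 < beta k) ->
  iint K (dir_w beta) = Zrec (avec beta) (beta ord0).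
Proof.
move=> b0; have [_] := hered_Wrec 1 (avec_gt0 b0) (b0 ord0).
rewrite size_avec oner_eq0 => /(_ isT); rewrite /pws ltr01 powR1 mulr1 => <-.
by apply: iint_ext => s sK; exact: dir_w_Wrec.
Qed.

Lemma val_addI K (k l : 'I_K.+2) : (k + l)%R = ((k + l) %% K.+2)%N :> nat.
Proof. by []. Qed.

Lemma lamN_rotS K s (k : 'I_K.+2) : size s = K.+1 -> lamN (rotS s) k = lamN s (k + 1)%R.
Proof.
case: s => [//|t s] [sK]; rewrite /rotS [behead _]/= val_addI (_ : nat_of_ord (1%R : 'I_K.+2) = 1%N)// addn1.
have [kK|kK] := ltnP k.+1 K.+2.
  rewrite modn_small//; case: k kK => -[|k] ? /= kK.
    by rewrite sum_rcons big_cons; ring.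
  by rewrite nth_rcons sK -ltnS -ltnS kK.
have -> : k = K.+1 :> nat by apply/eqP; rewrite eqn_leq -ltnS ltn_ord.
by rewrite modnn /= nth_rcons sK ltnn eqxx.
Qed.

Lemma iint_dir_rot K (beta : 'I_K.+2 -> R) (F : ('I_K.+2 -> R) -> R) :
  (forall k, 0 < beta k) -> contF F ->
  iint K.+1 (fun s => dir_w beta s * F (fun k => lamN s k)) =
  iint K.+1 (fun s => dir_w (fun k => beta (k - 1)) s * F (fun k => lamN s (k + 1)%R)).
Proof.
move=> b0 cF; rewrite -(iint_rotS (tame_dir b0 cF)); apply: iint_ext => s sK.
congr (_ * F _); last by apply/funext => k; rewrite lamN_rotS.
rewrite !dir_w_prod ?size_rcons ?size_behead ?sK//.
rewrite [RHS](reindex_inj (addIr 1)) /=; apply: eq_bigr => k _.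
by rewrite addrK lamN_rotS.
Qed.

Lemma contF_cst n (c : R) : contF (fun _ : 'I_n -> R => c).
Proof. by move=> v; exact: cst_continuous. Qed.

(** [iint_dir_rot] handles the numerator and, with the constant function 1, the normaliser. *)
Lemma dirE_rot K (beta : 'I_K.+2 -> R) (F : ('I_K.+2 -> R) -> R) :
  (forall k, 0 < beta k) -> contF F ->
  dirE beta F = dirE (fun k => beta (k - 1)) (fun lam => F (fun k => lam (k + 1))).
Proof.
move=> b0 cF; rewrite /dirE (iint_dir_rot b0 cF); congr (_ / _).
have E (b : 'I_K.+2 -> R) : (fun s => dir_w b s * (fun _ => 1) (fun k : 'I_K.+2 => lamN s k)) = dir_w b.
  by apply/funext => s; rewrite mulr1.
by have := iint_dir_rot b0 (@contF_cst K.+2 1); rewrite E => ->; congr iint; rewrite -[RHS]E.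
Qed.
End DirichletRotation.

(** * Beta identities, size-biasing and the mixture components *)

Section DirichletExpectation.
Variable R : realType.
Notation mu := (@lebesgue_measure R).
Notation RT := (measurableTypeR R).
Notation gt0s := (all (fun x : R => 0 < x)).

Lemma Rintegral_tpow (s : R) : 0 < s -> Rintegral mu setT (tpow s) = s^-1.
Proof. by move=> s0; rewrite /Rintegral integral_tpow. Qed.

Lemma betaR_r1 (b : R) : 0 < b -> betaR b 1 = b^-1.
Proof.
move=> b0; rewrite -(Rintegral_tpow b0).
(* [bint b 1 1] and [tpow b] can differ at both 0 and 1; [g] allows removing one point at a time. *)
pose g t := if t == 1 then 0 else tpow b t.
have it := integrable_tpow b0.
have [|ig <-] := @integrable_off_point R g (tpow b) 1 _ it.
  by move=> t /negbTE t1; rewrite /g t1.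
suff H t : t != 0 -> bint b 1 1 t = g t by exact: (integrable_off_point H ig).2.
move=> t0; rewrite /bint /g pw_pws// /tpow /pws subr_gt0 subrr powRr0.
have [->|t1] := eqVneq t 1; first by rewrite ltxx mulr0.
by rewrite [t <= 1]le_eqVlt (negbTE t1)/=; case: (t < 1); rewrite ?mulr1 ?mulr0.
Qed.

Lemma iint_dir_w_rot K (beta : 'I_K.+2 -> R) : (forall k, 0 < beta k) ->
  Zrec (avec beta) (beta ord0) =
  Zrec (avec (fun k => beta (k - 1))) (beta (ord0 - 1)).
Proof.
move=> b0; have b0' k : 0 < beta (k - 1) by exact: b0.
rewrite -(iint_dir_w b0) -(iint_dir_w b0').
have := iint_dir_rot b0 (@contF_cst R K.+2 1).
have E (b : 'I_K.+2 -> R) : (fun s => dir_w b s * (fun _ => 1) (fun k : 'I_K.+2 => lamN s k)) = dir_w b.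
  by apply/funext => s; rewrite mulr1.
by rewrite E => ->; congr iint; rewrite -[RHS]E.
Qed.

Lemma betaRC (a b : R) : 0 < a -> 0 < b -> betaR a b = betaR b a.
Proof.
move=> a0 b0; pose beta (k : 'I_2) := if k == ord0 then b else a.
have /iint_dir_w_rot : forall k, 0 < beta k by move=> k; rewrite /beta; case: ifP.
by rewrite /avec !enum_ordSl !enum_ord0 /= !big_nil !add0r !mulr1.
Qed.

(* Invariance of the Dirichlet normalisation under cyclic shifts, for three coordinates. *)
Lemma betaR_cocycle (a b c : R) : 0 < a -> 0 < b -> 0 < c ->
  betaR a (b + c) * betaR b c = betaR c (a + b) * betaR a b.
Proof.
move=> a0 b0 c0; pose beta (k : 'I_3) := nth 0 [:: c; a; b] k.
have /iint_dir_w_rot : forall k, 0 < beta k by move=> [[|[|[|k]]] kK].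
rewrite /avec !enum_ordSl !enum_ord0 /= !big_cons !big_nil !addr0 !add0r !mulr1.
by rewrite /beta.
Qed.

(** The cocycle identity at c = 1, with B(b, 1) = 1/b and B(1, a + b) = 1/(a + b). *)
Lemma betaR_rS (a b : R) : 0 < a -> 0 < b -> betaR a (b + 1) = b / (a + b) * betaR a b.
Proof.
move=> a0 b0; have ab0 : 0 < a + b by rewrite addr_gt0.
have := betaR_cocycle a0 b0 (@ltr01 R).
rewrite (betaRC ltr01 ab0) !betaR_r1// => E.
apply: (@mulIf _ b^-1); first by rewrite invr_eq0 gt_eqF.
by rewrite E; field; rewrite !gt_eqF.
Qed.

(** The factors of [betaR_rS] telescope along the stick-breaking product; the ratio left is the
    Dirichlet mean of the leftover coordinate. *)
Lemma Zrec_rS (a : seq R) (b : R) : gt0s a -> 0 < b ->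
  Zrec a (b + 1) = b / (\sum_(x <- a) x + b) * Zrec a b.
Proof.
move=> + b0; elim: a => [|x a IH] /=; first by rewrite big_nil add0r divff ?gt_eqF// mulr1.
move=> /andP[x0 a0]; have sa := sum_gt0s a0 b0.
have xsa : 0 < x + (\sum_(y <- a) y + b) by rewrite addr_gt0.
by rewrite IH// addrA betaR_rS// big_cons -addrA; field; rewrite !gt_eqF.
Qed.

Section Linearity.
Variables (K : nat) (beta : 'I_K.+1 -> R).
Hypothesis b0 : forall k, 0 < beta k.
Implicit Types F G : ('I_K.+1 -> R) -> R.

Lemma dirE_eq F G : (forall lam, \sum_k lam k = 1 -> F lam = G lam) -> dirE beta F = dirE beta G.
Proof.
by move=> FG; congr (_ / _); apply: iint_ext => s sK; rewrite FG// lamN_sum.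
Qed.

Lemma hered_dir F : contF F -> hered K (fun s => dir_w beta s * F (fun k => lamN s k)).
Proof. by move=> cF; exact: tame_hered (tame_dir b0 cF). Qed.

Lemma dirED F G : contF F -> contF G ->
  dirE beta (fun lam => F lam + G lam) = dirE beta F + dirE beta G.
Proof.
move=> cF cG; rewrite /dirE -mulrDl; congr (_ / _).
rewrite -(heredD (hered_dir cF) (hered_dir cG)).2.
by apply: iint_ext => s _; rewrite mulrDr.
Qed.

Lemma dirEZ (c : R) F : contF F -> dirE beta (fun lam => c * F lam) = c * dirE beta F.
Proof.
move=> cF; rewrite /dirE mulrA; congr (_ / _).
rewrite -(heredZ c (hered_dir cF)).2.
by apply: iint_ext => s _; rewrite mulrCA.
Qed.

Lemma dirE_sum (I : finType) (F : I -> ('I_K.+1 -> R) -> R) : (forall i, contF (F i)) ->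
  dirE beta (fun lam => \sum_i F i lam) = \sum_i dirE beta (F i).
Proof.
move=> cF; rewrite /dirE -mulr_suml; congr (_ / _).
rewrite -(hered_sum (fun i => hered_dir (cF i))).2.
by apply: iint_ext => s _; rewrite mulr_sumr.
Qed.

Lemma dirE1 : dirE beta (fun=> 1) = 1.
Proof.
rewrite /dirE (_ : iint _ _ = iint K (dir_w beta)).
  by rewrite divff// iint_dir_w// gt_eqF// Zrec_gt0// avec_gt0.
by apply: iint_ext => s _; rewrite mulr1.
Qed.

(* Size-biasing a Dirichlet law by its first coordinate increments the first parameter. *)
Lemma dirE_mul0 F :
  dirE beta (fun lam => lam ord0 * F lam) =
  beta ord0 / (\sum_k beta k) * dirE (fun k => beta k + (if val k == 0%N then 1 else 0)) F.
Proof.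
pose b' (k : 'I_K.+1) := beta k + (if val k == 0%N then 1 else 0); rewrite -/b'.
have b'0 k : 0 < b' k by rewrite /b'; case: ifP => _; rewrite ?addr0// addr_gt0.
rewrite /dirE !iint_dir_w//.
have -> : avec b' = avec beta by apply: eq_map => i; rewrite /b' /= addr0.
rewrite {1}/b' /= Zrec_rS ?avec_gt0// sum_avec.
rewrite (_ : iint K _ = iint K (fun s => dir_w b' s * F (fun k => lamN s k))).
  have Z0 : 0 < Zrec (avec beta) (beta ord0) by rewrite Zrec_gt0// avec_gt0.
  have S0 : 0 < \sum_k beta k by rewrite -sum_avec sum_gt0s// avec_gt0.
  have h0 := b0 ord0.
  by field; rewrite !gt_eqF.
apply: iint_ext => s sK; rewrite mulrA; congr (_ * _).
rewrite !dir_w_prod// !big_ord_recl mulrAC; congr (_ * _).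
  (* For t >= 0 the factor t raises the exponent by one, also at t = 0 because the parameter is
     positive. *)
  rewrite /b' /= /pw; case: leP => t0; last by rewrite mul0r.
  by rewrite addrK mulrC mulr_powRB1.
by apply: eq_bigr => i _; rewrite /b' /= addr0.
Qed.
End Linearity.

Lemma contF_comp_perm n (F : ('I_n -> R) -> R) (p : 'I_n -> 'I_n) : contF F ->
  contF (fun lam => F (fun k => lam (p k))).
Proof.
move=> cF; rewrite /contF.
rewrite (_ : (fun v : 'rV[R]_n => _) =
  (fun w : 'rV[R]_n => F (fun k => w 0 k)) \o (fun v : 'rV[R]_n => \row_k v 0 (p k))); last first.
  by apply/funext => v /=; congr F; apply/funext => k; rewrite mxE.
move=> v; apply: continuous_comp; last exact: cF.
move=> U /nbhs_ballP[e e0 eU]; apply/nbhs_ballP; exists e => // w [_ vw]; apply: eU; split=> // i j.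
by rewrite !mxE; exact: vw.
Qed.

Lemma dirE_ext n (b b' : 'I_n -> R) (F G : ('I_n -> R) -> R) :
  (forall k, b k = b' k) -> (forall lam, F lam = G lam) -> dirE b F = dirE b' G.
Proof. by move=> /funext -> /funext ->. Qed.

Lemma dirE_rotn K (beta : 'I_K.+2 -> R) (F : ('I_K.+2 -> R) -> R) (l : nat) :
  (forall k, 0 < beta k) -> contF F ->
  dirE beta F = dirE (fun k => beta (k - l%:R)) (fun lam => F (fun k => lam (k + l%:R))).
Proof.
move=> b0 cF; elim: l => [|l IH].
  apply: dirE_ext => [k|lam]; first by rewrite mulr0n subr0.
  by congr F; apply/funext => j; rewrite mulr0n addr0.
have cF' : contF (fun lam => F (fun k => lam (k + l%:R))) by exact: contF_comp_perm.
rewrite IH (dirE_rot _ cF') => [|k]; last exact: b0.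
apply: dirE_ext => [k|lam]; first by rewrite -addrA -opprD -[l.+1%:R]natr1 [l%:R + 1]addrC.
by congr F; apply/funext => j; rewrite -addrA natr1.
Qed.

(** Rotating coordinate [l] to the front and then size-biasing by it produces the l-th component of
    the mixture together with its weight. *)
Lemma dirE_mix K (alpha : 'I_K.+2 -> R) (F : ('I_K.+2 -> R) -> R) (l : 'I_K.+2) :
  (forall k, 0 < alpha k) -> contF F ->
  dirE alpha (fun lam => lam l * F (fun k => lam (k + l))) =
  alpha l / (\sum_i alpha i) * dirE (mixbeta alpha l) F.
Proof.
move=> a0 cF; have cG : contF (fun lam : 'I_K.+2 -> R => lam l * F (fun k => lam (k + l))).
  move=> v; apply: continuousM; first exact: coord_continuous.
  exact: (contF_comp_perm (p := fun k => k + l) cF).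
(* Rotations are counted by naturals; n - l of them amount to a shift by -l modulo n. *)
rewrite (dirE_rotn (K.+2 - l) a0 cG).
have lE : (K.+2 - l)%:R = - l :> 'I_K.+2.
  rewrite natrB ?(ltnW (ltn_ord l))// natr_Zp.
  by rewrite (_ : K.+2%:R = 0 :> 'I_K.+2) ?sub0r//; rewrite Zp_nat; apply/val_inj; exact: modnn.
rewrite (dirE_ext (b' := fun k => alpha (k + l)) (G := fun lam => lam ord0 * F lam)); last 2 first.
- by move=> k; rewrite lE opprK.
- move=> lam; rewrite lE subrr; congr (_ * F _).
  by apply/funext => k; rewrite addrK.
rewrite dirE_mul0; last by move=> k; exact: a0.
congr (_ / _ * _).
- by rewrite add0r.
- by rewrite [RHS](reindex_inj (addIr l)).
- apply: dirE_ext => // k; rewrite /mixbeta; congr (_ + _).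
  rewrite /cyc insubT ?ltn_mod// => h; congr alpha; apply/val_inj => /=.
  by rewrite addnC.
Qed.
End DirichletExpectation.

(** * Second-order Taylor expansion with Peano remainder *)

Section Taylor.
Variables (R : realType) (p : nat).
Implicit Types (phi f : 'rV[R]_p -> R) (z d v : 'rV[R]_p).
Notation dir k := (delta_mx 0 k : 'rV[R]_p).

Lemma rV_sum_delta v : v = \sum_k v 0 k *: dir k.
Proof. exact: row_sum_delta. Qed.

Lemma derive_sum_delta phi z v : differentiable phi z ->
  'D_v phi z = \sum_k v 0 k * 'D_(dir k) phi z.
Proof.
move=> dphi; rewrite deriveE// {1}(rV_sum_delta v) linear_sum /=.
by apply: eq_bigr => k _; rewrite linearZ /= deriveE.
Qed.

Lemma is_derive_ray phi z d t : differentiable phi (z + t *: d) ->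
  is_derive (t : R) (1 : R) (fun s : R => phi (z + s *: d)) ('D_d phi (z + t *: d)).
Proof.
move=> dphi.
have E : (fun h : R => h^-1 *: (((fun s : R => phi (z + s *: d)) \o shift t) (h *: (1 : R)) - phi (z + t *: d))) =
  (fun h : R => h^-1 *: ((phi \o shift (z + t *: d)) (h *: d) - phi (z + t *: d))).
  apply/funext => h /=; congr (_ *: (phi _ - _)).
  by rewrite [h *: 1]mulr1 scalerDl addrCA.
have : derivable phi (z + t *: d) d by exact: diff_derivable.
rewrite /derivable -E => dE.
by apply: DeriveDef => //; rewrite /derive E.
Qed.

(** The mean value theorem along the segment, applied to [phi] minus its quadratic model, turns the
    remainder into the error of linearising the partial derivatives at [z]; differentiability of
    these at [z] makes each error small. *)
Lemma taylor_peano2 phi z : (forall w, differentiable phi w) ->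
  (forall k, differentiable ('D_(dir k) phi) z) ->
  forall eps : R, 0 < eps -> exists2 del : R, 0 < del & forall d, `|d| < del ->
    `|phi (z + d) - (phi z + (grad phi z *m d^T) 0 0 + 2^-1 * (d *m hess phi z *m d^T) 0 0)|
      <= eps * `|d| ^+ 2.
Proof.
move=> dphi dg eps e0.
pose g k := 'D_(dir k) phi.
(* One share for each of the [p] coordinates; [p.+1] keeps the divisor nonzero when p = 0. *)
pose e' := eps / p.+1%:R.
have e'0 : 0 < e' by rewrite divr_gt0.
have near_g k : \forall w \near (0 : 'rV[R]_p), `|g k (w + z) - g k z - 'd (g k) z w| <= e' * `|w|.
  have /diff_locallyP[_ /eqaddoP/(_ e' e'0)] := dg k.
  by apply: filterS => w /=; rewrite !fctE opprD addrA.
have near_all : \forall w \near (0 : 'rV[R]_p), forall k, `|g k (w + z) - g k z - 'd (g k) z w| <= e' * `|w|.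
  exact: (@filter_forall _ _ (fun k w => `|g k (w + z) - g k z - 'd (g k) z w| <= e' * `|w|) _ _ near_g).
move: near_all => /nbhs_ballP[del /= del0 hdel]; exists del => // d dd.
pose A := (grad phi z *m d^T) 0 0; pose B := (d *m hess phi z *m d^T) 0 0.
have AE : A = \sum_k d 0 k * g k z.
  by rewrite /A mxE; apply: eq_bigr => k _; rewrite !mxE mulrC.
have BE : B = \sum_k d 0 k * 'd (g k) z d.
  rewrite /B mxE; apply: eq_bigr => k _; rewrite [RHS]mulrC !mxE -deriveE; last exact: dg.
  congr (_ * _); rewrite derive_sum_delta; last exact: dg.
  by apply: eq_bigr => j _; rewrite mxE.
pose psi (s : R) : R := phi (z + s *: d) - s * A - 2^-1 * s ^+ 2 * B.
have dpsi (s : R) : is_derive s (1 : R) psi ('D_d phi (z + s *: d) - A - s * B).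
  have -> : psi = (fun s : R => phi (z + s *: d)) - (A *: (id : R -> R)) - ((2^-1 * B) *: ((id : R -> R) * id)).
    by apply/funext => u; rewrite /psi !fctE /GRing.scale/=; ring.
  have dr := is_derive_ray (dphi (z + s *: d)).
  by apply: is_derive_eq; rewrite /GRing.scale/=; field.
have [|tau tau01 E] := @MVT R psi (fun s => 'D_d phi (z + s *: d) - A - s * B) 0 1 ltr01.
  by apply: derivable_within_continuous => u _; case: (dpsi u).
move: tau01; rewrite in_itv/= => /andP[tau0 tau1].
have -> : phi (z + d) - (phi z + A + 2^-1 * B) = psi 1 - psi 0.
  by rewrite /psi scale1r scale0r addr0; ring.
rewrite E subr0 mulr1 derive_sum_delta// AE BE mulr_sumr -!sumrB.
apply: le_trans (ler_norm_sum _ _ _) _.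
apply: (@le_trans _ _ (\sum_(k < p) e' * `|d| ^+ 2)); last first.
  rewrite sumr_const card_ord -mulr_natl mulrA ler_wpM2r ?exprn_ge0// /e'.
  by rewrite mulrCA ler_piMr ?(ltW e0)// ler_pdivrMr// mul1r ler_nat.
apply: ler_sum => k _.
have t1 : `|tau| <= 1 by rewrite ger0_norm ?ltW.
have tdd : `|tau *: d| <= `|d| by rewrite normrZ ler_piMl.
have /hdel/(_ k) : ball (0 : 'rV[R]_p) del (tau *: d).
  by rewrite -ball_normE /ball_/= sub0r normrN (le_lt_trans tdd).
rewrite linearZ [tau *: d + z]addrC -/(g k) => h.
rewrite (_ : _ - _ = d 0 k * (g k (z + tau *: d) - g k z - tau *: 'd (g k) z d)); last first.
  by rewrite /GRing.scale/= /g; ring.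
rewrite normrM [in leRHS]expr2 mulrA [e' * _]mulrC -mulrA; apply: ler_pM => //.
  by rewrite (_ : `|d| = mx_norm d)// mx_normrE; apply/bigmax_geP; right; exists (0, k).
by apply: le_trans h _; rewrite ler_wpM2l ?(ltW e'0).
Qed.
End Taylor.

(** * Derivatives and Taylor remainder of the loss *)

Section LossTaylor.
Variables (R : realType) (p m n : nat) (x : 'I_m -> 'rV[R]_p) (y : 'I_m -> R).
Variables (h : R -> R) (f : 'rV[R]_p -> R) (k0 : 'I_n).
Hypothesis dh : forall t : R, derivable h t 1 /\ derivable (derive1 h) t 1.
Hypothesis df : forall z : 'rV[R]_p, differentiable f z /\ forall v : 'rV[R]_p, differentiable ('D_v f) z.

Lemma derive_comp1 (g : R -> R) (z v : 'rV[R]_p) : differentiable f z -> derivable g (f z) 1 ->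
  'D_v (g \o f) z = derive1 g (f z) * 'D_v f z.
Proof.
move=> dfz /derivable1_diffP dg.
rewrite deriveE; last exact: differentiable_comp.
by rewrite diff_comp// diff1E//= -deriveE// mulrC.
Qed.

Lemma differentiable_comp1 (g : R -> R) (z : 'rV[R]_p) :
  derivable g (f z) 1 -> differentiable (g \o f) z.
Proof. by move=> /derivable1_diffP dg; apply: differentiable_comp => //; case: (df z). Qed.

Lemma lossE (y1 : R) : (fun z => loss h f z y1) = (h \o f) - y1 *: f.
Proof. by apply/funext. Qed.

Lemma differentiable_loss (y1 : R) z : differentiable (fun z => loss h f z y1) z.
Proof.
rewrite lossE; apply: differentiableB; first by apply: differentiable_comp1; case: (dh (f z)).
by apply: differentiableZ; case: (df z).
Qed.

Lemma deriveM_real (A B : 'rV[R]_p -> R) (z u : 'rV[R]_p) (a b : R) :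
  derivable A z u -> derivable B z u -> 'D_u A z = a -> 'D_u B z = b ->
  'D_u (A * B) z = A z * b + B z * a.
Proof. by move=> dA dB <- <-; exact: deriveM. Qed.

Lemma derive_loss_at (y1 : R) v z :
  'D_v (fun z => loss h f z y1) z = (derive1 h (f z) - y1) * 'D_v f z.
Proof.
have [dfz _] := df z; have [dhz _] := dh (f z).
rewrite lossE deriveB; [|by apply: diff_derivable; apply: differentiable_comp1|
  by apply: diff_derivable; apply: differentiableZ].
rewrite deriveZ; last exact: diff_derivable.
by rewrite derive_comp1// mulrBl.
Qed.

Lemma derive_loss (y1 : R) v : 'D_v (fun z => loss h f z y1) =
  ((derive1 h \o f) - cst y1) * 'D_v f.
Proof.
by apply/funext => z; rewrite derive_loss_at.
Qed.

Lemma differentiable_derive_loss (y1 : R) v z : differentiable ('D_v (fun z => loss h f z y1)) z.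
Proof.
rewrite derive_loss; apply: differentiableM; last by case: (df z) => _; exact.
by apply: differentiableB => //; apply: differentiable_comp1; case: (dh (f z)).
Qed.

Lemma derive2_loss (y1 : R) u v z : 'D_u ('D_v (fun z => loss h f z y1)) z =
  (derive1 h (f z) - y1) * 'D_u ('D_v f) z + derive1 (derive1 h) (f z) * 'D_u f z * 'D_v f z.
Proof.
have [dfz d2f] := df z; have [_ dh2] := dh (f z).
have dhf : derivable (derive1 h \o f) z u by apply: diff_derivable; exact: differentiable_comp1.
have dc : derivable (cst y1 : 'rV[R]_p -> R) z u by exact: derivable_cst.
have dB := derivableB dhf dc.
have dv : derivable ('D_v f) z u by apply: diff_derivable; exact: d2f.
have E : 'D_u ((derive1 h \o f) - cst y1) z = derive1 (derive1 h) (f z) * 'D_u f z.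
  rewrite (deriveB dhf dc) [X in _ - X](_ : _ = 0); last exact: derive_cst.
  by rewrite subr0 (derive_comp1 u dfz dh2).
rewrite derive_loss (deriveM_real dB dv E erefl).
by congr (_ + _); exact: mulrC.
Qed.

Lemma grad_loss (y1 : R) z : grad (fun z => loss h f z y1) z = (derive1 h (f z) - y1) *: grad f z.
Proof. by apply/rowP => k; rewrite !mxE derive_loss_at. Qed.

(** The Hessian of f feeds [R3], the rank-one part feeds [R2]. *)
Lemma hess_loss (y1 : R) z : hess (fun z => loss h f z y1) z =
  (derive1 h (f z) - y1) *: hess f z + derive1 (derive1 h) (f z) *: ((grad f z)^T *m grad f z).
Proof.
apply/matrixP => j k; rewrite !mxE derive2_loss; congr (_ + _).
by rewrite big_ord1 !mxE mulrA.
Qed.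

Lemma taylor_remE (i : {ffun 'I_n -> 'I_m}) lam :
  let z := x (i k0) in let d := mix_delta x k0 i lam in
  let phi := fun z => loss h f z (y (i k0)) in
  taylor_rem x y h f k0 i lam =
  phi (z + d) - (phi z + (grad phi z *m d^T) 0 0 + 2^-1 * (d *m hess phi z *m d^T) 0 0).
Proof.
move=> z d phi; rewrite /taylor_rem -/z -/d /phi grad_loss hess_loss.
rewrite -scalemxAl mulmxDr mulmxDl -!scalemxAr -!scalemxAl.
have E : (d *m ((grad f z)^T *m grad f z) *m d^T) 0 0 = ((grad f z *m d^T) 0 0) ^+ 2.
  rewrite !mulmxA -mulmxA mxE big_ord1 expr2; congr (_ * _).
  have T (A : 'M[R]_1) : A^T 0 0 = A 0 0 by rewrite mxE.
  by rewrite -T trmx_mul trmxK.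
have addE (A B : 'M[R]_(1, 1)) : (A + B)%R 0 0 = A 0 0 + B 0 0 by rewrite mxE.
have scE a (A : 'M[R]_(1, 1)) : (a *: A)%R 0 0 = a * A 0 0 by rewrite mxE.
by rewrite addE !scE E; ring.
Qed.

Lemma norm_mix_delta (i : {ffun 'I_n -> 'I_m}) (lam : 'I_n -> R) (r : R) :
  (forall k, k != k0 -> `|lam k| <= r) ->
  `|mix_delta x k0 i lam| <= r * \sum_(k | k != k0) `|x (i k) - x (i k0)|.
Proof.
move=> lr; rewrite /mix_delta mulr_sumr; apply: le_trans (ler_norm_sum _ _ _) _.
by apply: ler_sum => k kk0; rewrite normrZ ler_wpM2r// lr.
Qed.

Lemma taylor_rem_littleo (i : {ffun 'I_n -> 'I_m}) (eps : R) : 0 < eps ->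
  exists2 d : R, 0 < d & forall lam : 'I_n -> R, (forall k, k != k0 -> `|lam k| < d) ->
    `|taylor_rem x y h f k0 i lam| <= eps * sq_rest k0 lam.
Proof.
move=> e0; set phi := fun z => loss h f z (y (i k0)).
pose X := \sum_(k | k != k0) `|x (i k) - x (i k0)|.
have X0 : 0 <= X by exact: sumr_ge0.
(* The displacement is at most r X, with r the Euclidean norm of the lambda_k, k != k0; the final
   bound is e' X^2 r^2 <= eps r^2, and the +1 covers X = 0. *)
pose e' := eps / (X ^+ 2 + 1).
have X21 : 0 < X ^+ 2 + 1 by rewrite ltr_wpDl// exprn_ge0.
have e'0 : 0 < e' by rewrite divr_gt0.
have [del del0 hdel] := taylor_peano2 (differentiable_loss (y (i k0)))
   (fun k => differentiable_derive_loss (y (i k0)) (delta_mx 0 k) (x (i k0))) e'0.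
have X1 : 0 < X + 1 by rewrite ltr_wpDl.
exists (del / (X + 1)); first by rewrite divr_gt0.
move=> lam hlam; rewrite taylor_remE -/phi.
have dd : `|mix_delta x k0 i lam| < del.
  have hl k : k != k0 -> `|lam k| <= del / (X + 1) by move=> /hlam /ltW.
  apply: le_lt_trans (norm_mix_delta i hl) _.
  by rewrite -/X -mulrA gtr_pMr// mulrC ltr_pdivrMr// mul1r ltrDl.
apply: le_trans (hdel _ dd) _.
have sq0 : 0 <= sq_rest k0 lam by apply: sumr_ge0 => k _; exact: sqr_ge0.
pose r := Num.sqrt (sq_rest k0 lam).
have dr : `|mix_delta x k0 i lam| <= r * X.
  apply: norm_mix_delta => k kk0; rewrite -sqrtr_sqr ler_sqrt//.
  by rewrite /sq_rest (bigD1 k)//= lerDl; apply: sumr_ge0 => j _; exact: sqr_ge0.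
apply: (@le_trans _ _ (e' * (r * X) ^+ 2)).
  by rewrite ler_wpM2l ?(ltW e'0)// lerXn2r ?nnegrE// mulr_ge0// sqrtr_ge0.
rewrite exprMn sqr_sqrtr// mulrCA mulrC ler_wpM2r//.
by rewrite /e' mulrAC ler_pdivrMr// ler_wpM2l ?(ltW e0)// lerDl.
Qed.
End LossTaylor.

(** * Averages over index tuples *)

Section Averages.
Variables (R : realType) (p m n : nat) (x : 'I_m -> 'rV[R]_p) (k0 : 'I_n).
Notation M := (m%:R : R).
Implicit Types (i : {ffun 'I_n -> 'I_m}) (G : {ffun 'I_n -> 'I_m} -> R).

Definition upd i (k : 'I_n) (b : 'I_m) : {ffun 'I_n -> 'I_m} :=
  [ffun j => if j == k then b else i j].

Definition avg G : R := (M ^+ n)^-1 * \sum_i G i.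
Definition mean (u : 'I_m -> R) : R := M^-1 * \sum_a u a.

Lemma avgD G H : avg (fun i => G i + H i) = avg G + avg H.
Proof. by rewrite /avg big_split mulrDr. Qed.

Lemma avgZ c G : avg (fun i => c * G i) = c * avg G.
Proof. by rewrite /avg -mulr_sumr mulrCA. Qed.

Lemma avg_sum (I : finType) (P : pred I) (G : I -> {ffun 'I_n -> 'I_m} -> R) :
  avg (fun i => \sum_(k | P k) G k i) = \sum_(k | P k) avg (G k).
Proof. by rewrite /avg exchange_big mulr_sumr. Qed.

Lemma eq_avg G H : (forall i, G i = H i) -> avg G = avg H.
Proof. by move=> GH; congr (_ * _); apply: eq_bigr. Qed.

Lemma avg_m0 G : m = 0%N -> avg G = 0.
Proof.
move=> m0; have -> : avg G = ((0%:R : R) ^+ n)^-1 * \sum_i G i by rewrite -[X in X%:R]m0.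
(* The index [k0] witnesses n > 0, so 0 ^ n is 0, with inverse 0. *)
by rewrite expr0n gtn_eqF ?invr0 ?mul0r//; case: k0 => k; exact: leq_ltn_trans.
Qed.

(* Redrawing one index leaves the average over all index tuples unchanged. *)
Lemma avg_resample k G : avg G = avg (fun i => mean (fun b => G (upd i k b))).
Proof.
have [m0|m0] := eqVneq m 0%N; first by rewrite !avg_m0.
have M0 : M != 0 by rewrite pnatr_eq0.
congr (_ * _); rewrite -mulr_sumr; apply: (mulfI M0); rewrite mulVKf//.
(* Exchanging the fresh value with the stored entry is an involution on pairs, hence a valid
   reindexing. *)
pose psi (z : {ffun 'I_n -> 'I_m} * 'I_m) := (upd z.1 k z.2, z.1 k).
have psiK : involutive psi.
  move=> [i b]; congr (_, _); last by rewrite /= ffunE eqxx.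
  by apply/ffunP => j; rewrite !ffunE; case: eqP => [->|].
rewrite pair_bigA /= (reindex_inj (inv_inj psiK)) /=.
rewrite (eq_bigr (fun z : {ffun 'I_n -> 'I_m} * 'I_m => G z.1)); last first.
  move=> [i b] _ /=; congr G; apply/ffunP => j; rewrite !ffunE.
  by case: eqP => [->|].
rewrite -(pair_bigA _ (fun i _ => G i)) /= mulr_sumr; apply: eq_bigr => i _.
by rewrite sumr_const card_ord mulr_natl.
Qed.

Lemma avg1 k (u : 'I_m -> R) : avg (fun i => u (i k)) = mean u.
Proof.
rewrite (avg_resample k) (@eq_avg _ (fun=> mean u)); last first.
  by move=> i; congr (_ * _); apply: eq_bigr => b _; rewrite ffunE eqxx.
have [m0|m0] := eqVneq m 0%N; first by rewrite avg_m0// /mean (_ : M = 0) ?invr0 ?mul0r// m0.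
rewrite /avg sumr_const card_ffun !card_ord -[_ *+ (m ^ n)]mulr_natl natrX mulKf//.
by rewrite expf_neq0// pnatr_eq0.
Qed.

Lemma avg2 k l (w : 'I_m -> 'I_m -> R) : k != l ->
  avg (fun i => w (i k) (i l)) = mean (fun a => mean (w a)).
Proof.
move=> kl; rewrite (avg_resample l) -(avg1 k); apply: eq_avg => i.
by congr (_ * _); apply: eq_bigr => b _; rewrite !ffunE (negbTE kl) eqxx.
Qed.

Lemma avg3 k l j (w : 'I_m -> 'I_m -> 'I_m -> R) : k != l -> k != j -> l != j ->
  avg (fun i => w (i k) (i l) (i j)) = mean (fun a => mean (fun b => mean (w a b))).
Proof.
move=> kl kj lj; rewrite (avg_resample j) -(avg2 _ kl); apply: eq_avg => i.
by congr (_ * _); apply: eq_bigr => b _; rewrite !ffunE (negbTE kj) (negbTE lj) eqxx.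
Qed.

Lemma mx11_sum (I : Type) (r : seq I) (P : pred I) (F : I -> 'M[R]_(1, 1)) :
  (\sum_(k <- r | P k) F k) 0 0 = \sum_(k <- r | P k) F k 0 0.
Proof. exact: summxE. Qed.

Lemma mul_sum_tr (I : Type) (r : seq I) (P : pred I) q (A : 'rV[R]_q) (s : I -> R) (v : I -> 'rV[R]_q) :
  (A *m (\sum_(k <- r | P k) s k *: v k)^T) 0 0 =
  \sum_(k <- r | P k) s k * (A *m (v k)^T) 0 0.
Proof.
rewrite linear_sum mulmx_sumr mx11_sum; apply: eq_bigr => k _.
by rewrite linearZ /= -scalemxAr mxE.
Qed.

Lemma quad_sum (I J : Type) (r : seq I) (P : pred I) (r' : seq J) (P' : pred J) q
    (Q : 'M[R]_q) (s : I -> R) (v : I -> 'rV[R]_q) (s' : J -> R) (v' : J -> 'rV[R]_q) :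
  ((\sum_(k <- r | P k) s k *: v k) *m Q *m (\sum_(l <- r' | P' l) s' l *: v' l)^T) 0 0 =
  \sum_(k <- r | P k) \sum_(l <- r' | P' l) s k * s' l * (v k *m Q *m (v' l)^T) 0 0.
Proof.
rewrite mulmx_suml mulmx_suml mx11_sum; apply: eq_bigr => k _.
rewrite mul_sum_tr; apply: eq_bigr => l _.
by rewrite -!scalemxAl mxE mulrCA mulrA.
Qed.

Lemma EX_sum a : EX x a = \sum_b M^-1 *: (x b - x a).
Proof. by rewrite /EX scaler_sumr. Qed.

(** Distinct entries of a uniform tuple are independent. Given entry [k0], each linear term averages
    to the same mean; a quadratic term (k, l) gives [EquadH] if k = l and factorises through [EX] on
    both sides otherwise. *)
Lemma avg_taylor (L : 'I_m -> R) (A : 'I_m -> 'rV[R]_p) (Q : 'I_m -> 'M[R]_p) (lam : 'I_n -> R) :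
  \sum_k lam k = 1 ->
  avg (fun i => L (i k0) + (A (i k0) *m (mix_delta x k0 i lam)^T) 0 0
     + 2^-1 * (mix_delta x k0 i lam *m Q (i k0) *m (mix_delta x k0 i lam)^T) 0 0) =
  mean L + (1 - lam k0) * mean (fun a => (A a *m (EX x a)^T) 0 0)
  + sq_rest k0 lam * (2^-1 * mean (fun a => EquadH x a (Q a)))
  + ((1 - lam k0) ^+ 2 - sq_rest k0 lam) * (2^-1 * mean (fun a => (EX x a *m Q a *m (EX x a)^T) 0 0)).
Proof.
move=> lam1.
have S1 : \sum_(k | k != k0) lam k = 1 - lam k0 by move: lam1; rewrite (bigD1 k0)//= => <-; rewrite [lam k0 + _]addrC addrK.
rewrite !avgD avg1 avgZ -!addrA; congr (_ + _).
rewrite (@eq_avg _ (fun i => \sum_(k | k != k0) lam k * (A (i k0) *m (x (i k) - x (i k0))^T) 0 0)); last first.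
  by move=> i; rewrite mul_sum_tr.
rewrite avg_sum (eq_bigr (fun k => lam k * mean (fun a => (A a *m (EX x a)^T) 0 0))); last first.
  move=> k kk0; rewrite avgZ; congr (_ * _).
  rewrite (@avg2 k0 k (fun a b => (A a *m (x b - x a)^T) 0 0)) 1?eq_sym//.
  congr (_ * _); apply: eq_bigr => a _.
  by rewrite EX_sum mul_sum_tr -mulr_sumr.
rewrite -mulr_suml S1; congr (_ + _).
rewrite (@eq_avg _ (fun i => \sum_(k | k != k0) \sum_(l | l != k0)
   lam k * lam l * ((x (i k) - x (i k0)) *m Q (i k0) *m (x (i l) - x (i k0))^T) 0 0)); last first.
  by move=> i; rewrite quad_sum.
set Q1 := mean _; set Q2 := mean _.
(* For fixed k, the pair l = k contributes [Q1]; the remaining l contribute [Q2], and their lam l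
   sum to 1 - lam k0 - lam k. *)
rewrite avg_sum (eq_bigr (fun k => lam k ^+ 2 * Q1 + lam k * (1 - lam k0 - lam k) * Q2)); last first.
  move=> k kk0; rewrite avg_sum (bigD1 k)//=; congr (_ + _).
    rewrite avgZ -expr2; congr (_ * _).
    by rewrite (@avg2 k0 k (fun a b => ((x b - x a) *m Q a *m (x b - x a)^T) 0 0)) 1?eq_sym.
  rewrite (eq_bigr (fun l => lam k * lam l * Q2)); last first.
    move=> l /andP[lk0 lk]; rewrite avgZ; congr (_ * _).
    have [k0k k0l kl] : [/\ k0 != k, k0 != l & k != l] by split; rewrite eq_sym.
    rewrite (@avg3 k0 k l (fun a b c => ((x b - x a) *m Q a *m (x c - x a)^T) 0 0))//.
    congr (_ * _); apply: eq_bigr => a _.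
    rewrite EX_sum quad_sum /mean mulr_sumr; apply: eq_bigr => b _.
    by rewrite mulrA mulr_sumr.
  rewrite -mulr_suml -mulr_sumr -S1 (bigD1 k kk0)/= [lam k + _]addrC addrK.
  by congr (_ * _ * _); apply: eq_bigl => l.
rewrite big_split /= -!mulr_suml -/(sq_rest k0 lam).
have -> : \sum_(k | k != k0) lam k * (1 - lam k0 - lam k) = (1 - lam k0) ^+ 2 - sq_rest k0 lam.
  rewrite (eq_bigr (fun k => lam k * (1 - lam k0) - lam k ^+ 2)); last by move=> k _; rewrite mulrBr expr2.
  by rewrite sumrB -mulr_suml S1 expr2.
by ring.
Qed.
End Averages.

(** * Continuity of the integrands and linearity of the mixture expectation *)

Section ContF.
Variables (R : realType) (n : nat).
Implicit Types F G : ('I_n -> R) -> R.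

Lemma contFD F G : contF F -> contF G -> contF (fun lam => F lam + G lam).
Proof. by move=> cF cG v; apply: continuousD; [exact: cF|exact: cG]. Qed.

Lemma contFM F G : contF F -> contF G -> contF (fun lam => F lam * G lam).
Proof. by move=> cF cG v; apply: continuousM; [exact: cF|exact: cG]. Qed.

Lemma contFZ c F : contF F -> contF (fun lam => c * F lam).
Proof. by apply: contFM; exact: contF_cst. Qed.

Lemma contFB F G : contF F -> contF G -> contF (fun lam => F lam - G lam).
Proof. by move=> cF cG v; apply: continuousB; [exact: cF|exact: cG]. Qed.

Lemma contF_coord k : contF (fun lam : 'I_n -> R => lam k).
Proof. by move=> v; exact: coord_continuous. Qed.

Lemma contF_sum (I : Type) (r : seq I) (P : pred I) (F : I -> ('I_n -> R) -> R) :
  (forall i, contF (F i)) -> contF (fun lam => \sum_(i <- r | P i) F i lam).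
Proof.
move=> cF; elim: r => [|i r IH].
  by under eq_fun do rewrite big_nil; exact: contF_cst.
under eq_fun do rewrite big_cons; case: (P i) => //.
exact: (contFD (cF i) IH).
Qed.

Lemma contF_comb p (g : 'rV[R]_p -> R) (r : seq 'I_n) (P : pred 'I_n) (c : 'rV[R]_p) (w : 'I_n -> 'rV[R]_p) :
  continuous g -> contF (fun lam => g (c + \sum_(k <- r | P k) lam k *: w k)).
Proof.
move=> cg.
pose S r (v : 'rV[R]_n) : 'rV[R]_p := \sum_(k <- r | P k) v 0 k *: w k.
have cS : continuous (S r).
  elim: r => [|k r IH].
    rewrite (_ : S [::] = cst 0); first by move=> v; exact: cst_continuous.
    by apply/funext => v; rewrite /S big_nil.
  rewrite (_ : S (k :: r) = if P k then (fun v : 'rV[R]_n => v 0 k *: w k) + S r else S r); last first.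
    by apply/funext => v; rewrite /S big_cons; case: (P k).
  case: (P k) => // v; apply: continuousD; last exact: IH.
  by apply: continuousZr_tmp; exact: coord_continuous.
move=> v; apply: (@continuous_comp _ _ _ (fun v => c + S r v) g); last exact: cg.
by apply: continuousD; [exact: cst_continuous|exact: cS].
Qed.
End ContF.

Section TildeE.
Variables (R : realType) (K : nat) (alpha : 'I_K.+2 -> R).
Hypothesis a0 : forall k, 0 < alpha k.
Implicit Types F G : ('I_K.+2 -> R) -> R.

Lemma mixbeta_gt0 l k : 0 < mixbeta alpha l k.
Proof.
rewrite /mixbeta /cyc insubT ?ltn_mod// => h.
by case: ifP => _; rewrite ?addr0// addr_gt0.
Qed.

Lemma tildeE_eq F G : (forall lam, \sum_k lam k = 1 -> F lam = G lam) -> tildeE alpha F = tildeE alpha G.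
Proof. by move=> FG; apply: eq_bigr => l _; rewrite (dirE_eq _ FG). Qed.

Lemma tildeED F G : contF F -> contF G ->
  tildeE alpha (fun lam => F lam + G lam) = tildeE alpha F + tildeE alpha G.
Proof.
move=> cF cG; rewrite /tildeE -big_split; apply: eq_bigr => l _ /=.
by rewrite -mulrDr (dirED (mixbeta_gt0 l)).
Qed.

Lemma tildeEZ c F : contF F -> tildeE alpha (fun lam => c * F lam) = c * tildeE alpha F.
Proof.
move=> cF; rewrite /tildeE mulr_sumr; apply: eq_bigr => l _ /=.
by rewrite (dirEZ (mixbeta_gt0 l))// mulrCA.
Qed.

Lemma tildeE_sum (I : finType) (F : I -> ('I_K.+2 -> R) -> R) : (forall i, contF (F i)) ->
  tildeE alpha (fun lam => \sum_i F i lam) = \sum_i tildeE alpha (F i).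
Proof.
move=> cF; rewrite /tildeE exchange_big; apply: eq_bigr => l _ /=.
by rewrite (dirE_sum (mixbeta_gt0 l))// mulr_sumr.
Qed.

Lemma tildeE_cst c : tildeE alpha (fun=> c) = c.
Proof.
rewrite (tildeE_eq (G := fun=> c * 1)); last by move=> *; rewrite mulr1.
rewrite (tildeEZ c (@contF_cst R K.+2 1)) /tildeE.
under eq_bigr => l _ do rewrite (dirE1 (mixbeta_gt0 l)) mulr1.
rewrite -mulr_suml divff ?mulr1// gt_eqF//.
by rewrite (bigD1 ord0)//= ltr_pwDl// sumr_ge0// => i _; exact: ltW.
Qed.
End TildeE.

(** * The Mixup loss as a mixture expectation, and its expansion *)

Section Mixup.
Variables (R : realType) (p m K : nat) (x : 'I_m -> 'rV[R]_p) (y : 'I_m -> R).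
Variables (h : R -> R) (f : 'rV[R]_p -> R) (alpha : 'I_K.+2 -> R).
Hypothesis dh : forall t : R, derivable h t 1 /\ derivable (derive1 h) t 1.
Hypothesis df : forall z : 'rV[R]_p, differentiable f z /\ forall v : 'rV[R]_p, differentiable ('D_v f) z.
Hypothesis a0 : forall k, 0 < alpha k.
Notation n := K.+2.

Lemma continuous_loss (y1 : R) : continuous (fun z => loss h f z y1).
Proof. by move=> z; apply: differentiable_continuous; exact: differentiable_loss. Qed.

Lemma loss_comb (z : 'rV[R]_p) (lam yy : 'I_n -> R) : \sum_k lam k = 1 ->
  loss h f z (\sum_k lam k * yy k) = \sum_k lam k * loss h f z (yy k).
Proof.
move=> lam1; rewrite /loss; under [RHS]eq_bigr do rewrite mulrBr.
rewrite sumrB -mulr_suml lam1 mul1r mulr_suml; congr (_ - _).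
by apply: eq_bigr => k _; rewrite mulrA.
Qed.

(* Splitting the convex combination of labels, then rotating the simplex so that the
   chosen label becomes the first one, turns Dir(alpha) into the mixture tilde D. *)
Lemma Lnmix_tildeE : Lnmix x y h f alpha =
  (m%:R ^+ n)^-1 * \sum_(i : {ffun 'I_n -> 'I_m})
    tildeE alpha (fun lam => loss h f (\sum_k lam k *: x (i k)) (y (i ord0))).
Proof.
congr (_ * _).
pose F (i : {ffun 'I_n -> 'I_m}) (lam : 'I_n -> R) := loss h f (\sum_k lam k *: x (i k)) (y (i ord0)).
have cF i : contF (F i).
  rewrite /F; under eq_fun do rewrite -[\sum_k _]add0r.
  exact: contF_comb (@continuous_loss _).
pose shift (l : 'I_n) (i : {ffun 'I_n -> 'I_m}) : {ffun 'I_n -> 'I_m} := [ffun k => i (k - l)].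
have shift_inj l : injective (shift l).
  move=> i j /ffunP E; apply/ffunP => k.
  by have := E (k + l); rewrite !ffunE addrK.
transitivity (\sum_(i : {ffun 'I_n -> 'I_m}) \sum_(l < n)
  dirE alpha (fun lam => lam l * loss h f (\sum_k lam k *: x (i k)) (y (i l)))).
  apply: eq_bigr => i _; rewrite -dirE_sum//; last first.
    move=> l; apply: contFM; first exact: contF_coord.
    under eq_fun do rewrite -[\sum_k _]add0r.
    exact: contF_comb (@continuous_loss _).
  by apply: dirE_eq => lam lam1; rewrite loss_comb.
rewrite exchange_big /= /tildeE [RHS]exchange_big /=; apply: eq_bigr => l _.
(* Relabelling the tuples by the shift moves label [l] to position 0 and matches the rotated weights
   with the rotated inputs. *)
rewrite (reindex_inj (shift_inj l)) /=; apply: eq_bigr => i _.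
rewrite -(dirE_mix l a0 (cF i)); apply: dirE_eq => lam _; congr (_ * loss _ _ _ _).
  rewrite (reindex_inj (addIr l)) /=; apply: eq_bigr => k _.
  by rewrite ffunE addrK.
by rewrite ffunE subrr.
Qed.

Lemma comb_mix_delta (i : {ffun 'I_n -> 'I_m}) (lam : 'I_n -> R) : \sum_k lam k = 1 ->
  \sum_k lam k *: x (i k) = x (i ord0) + mix_delta x ord0 i lam.
Proof.
move=> lam1; rewrite /mix_delta.
rewrite (eq_bigr (fun k => lam k *: x (i k) - lam k *: x (i ord0)) (P := fun k => k != ord0)); last first.
  by move=> k _; rewrite scalerBr.
rewrite sumrB -scaler_suml (bigD1 ord0)//=.
have -> : \sum_(k | k != ord0) lam k = 1 - lam ord0.
  by move: lam1; rewrite (bigD1 ord0)//= => <-; rewrite [lam ord0 + _]addrC addrK.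
by rewrite scalerBl scale1r opprB addrC [RHS]addrCA [x _ + _]addrC subrK.
Qed.

Lemma mx11D (A B : 'M[R]_(1, 1)) : (A + B)%R 0 0 = A 0 0 + B 0 0.
Proof. by rewrite mxE. Qed.

Lemma mx11Z c (A : 'M[R]_(1, 1)) : (c *: A)%R 0 0 = c * A 0 0.
Proof. by rewrite mxE. Qed.

Lemma mul_tr_rV q (v w : 'rV[R]_q) : (v *m w^T) 0 0 = (w *m v^T) 0 0.
Proof.
have T (A : 'M[R]_1) : A^T 0 0 = A 0 0 by rewrite mxE.
by rewrite -T trmx_mul trmxK.
Qed.

Lemma mul_rank1 q (u v w z : 'rV[R]_q) :
  (u *m (v^T *m w) *m z^T) 0 0 = (u *m v^T) 0 0 * (w *m z^T) 0 0.
Proof. by rewrite !mulmxA -mulmxA mxE big_ord1. Qed.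

(** The rank-one part is the square of the scalar g u^T, so [u] and [g] can trade places; this puts
    the moments of the data in the middle, as in [R2]. *)
Lemma quad_rank1 q (u g : 'rV[R]_q) (H : 'M[R]_q) (c d : R) :
  (u *m (c *: H + d *: (g^T *m g)) *m u^T) 0 0 =
  c * (u *m H *m u^T) 0 0 + d * (g *m (u^T *m u) *m g^T) 0 0.
Proof.
rewrite mulmxDr mulmxDl -!scalemxAr -!scalemxAl mx11D !mx11Z; congr (_ + _ * _).
by rewrite !mul_rank1 mulrC; congr (_ * _); exact: mul_tr_rV.
Qed.

Lemma EquadH_rank1 a (g : 'rV[R]_p) (H : 'M[R]_p) (c d : R) :
  EquadH x a (c *: H + d *: (g^T *m g)) =
  c * EquadH x a H + d * (g *m EXX x a *m g^T) 0 0.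
Proof.
rewrite /EquadH; under eq_bigr do rewrite quad_rank1.
rewrite big_split /= -!mulr_sumr mulrDr mulrCA; congr (_ + _).
rewrite mulrCA /EXX -scalemxAr -scalemxAl mx11Z; congr (_ * (_ * _)).
by rewrite mulmx_sumr mulmx_suml mx11_sum.
Qed.

(** For each lambda on the simplex, the averaged remainder is the averaged loss [aF] minus the
    averaged Taylor polynomial [Tl]. Applying the linear [tildeE] and sorting the terms of [Tl]
    gives the identity. *)
Lemma Lnmix_taylor : Lnmix x y h f alpha =
    Lm x y h f + R1 x y h f alpha ord0 + R2 x h f alpha ord0
    + R3 x y h f alpha ord0 + Rrem x y h f alpha ord0.
Proof.
rewrite Lnmix_tildeE.
pose phi a := fun z => loss h f z (y a).
pose T := mean (fun a => phi a (x a)).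
pose T1 := mean (fun a => (grad (phi a) (x a) *m (EX x a)^T) 0 0).
pose T2 := 2^-1 * mean (fun a => EquadH x a (hess (phi a) (x a))).
pose T3 := 2^-1 * mean (fun a => (EX x a *m hess (phi a) (x a) *m (EX x a)^T) 0 0).
pose F (i : {ffun 'I_n -> 'I_m}) (lam : 'I_n -> R) := phi (i ord0) (x (i ord0) + mix_delta x ord0 i lam).
pose B0 (lam : 'I_n -> R) := 1 - lam ord0.
pose B2 (lam : 'I_n -> R) := (1 - lam ord0) ^+ 2 - sq_rest ord0 lam.
have cF i : contF (F i) by exact: contF_comb (@continuous_loss _).
have cB0 : contF B0 by apply: contFB; [exact: contF_cst|exact: contF_coord].
have csq : contF (sq_rest (ord0 : 'I_n) : _ -> R).
  by apply: contF_sum => k; apply: contFM; exact: contF_coord.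
have cB2 : contF B2 by apply: contFB => //; exact: contFM.
pose Tl lam := T + (T1 * B0 lam + (T2 * sq_rest ord0 lam + T3 * B2 lam)).
have cTl : contF Tl.
  apply: contFD; first exact: contF_cst.
  by apply: contFD; [exact: contFZ|apply: contFD; exact: contFZ].
pose aF (lam : 'I_n -> R) := (m%:R ^+ n)^-1 * \sum_i F i lam.
have caF : contF aF by apply: contFZ; apply: contF_sum => i; exact: cF.
have remE : Rrem x y h f alpha ord0 = tildeE alpha (fun lam => aF lam + -1 * Tl lam).
  apply: tildeE_eq => lam lam1.
  have := avg_taylor x ord0 (fun a => phi a (x a)) (fun a => grad (phi a) (x a)) (fun a => hess (phi a) (x a)) lam1.
  rewrite -/T -/T1 -/T2 -/T3 => E.
  rewrite (_ : Tl lam = T + (1 - lam ord0) * T1 + sq_rest ord0 lam * T2 + B2 lam * T3); last first.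
    by rewrite /Tl /B0; ring.
  rewrite -E /avg mulN1r /aF -mulrBr -sumrB; congr (_ * _).
  by apply: eq_bigr => i _; rewrite taylor_remE.
have LE : (m%:R ^+ n)^-1 * \sum_(i : {ffun 'I_n -> 'I_m})
    tildeE alpha (fun lam => loss h f (\sum_k lam k *: x (i k)) (y (i ord0))) = tildeE alpha aF.
  rewrite (tildeEZ a0) ?(tildeE_sum a0)//; last by apply: contF_sum => i; exact: cF.
  congr (_ * _); apply: eq_bigr => i _; apply: tildeE_eq => lam lam1.
  by rewrite /F /phi comb_mix_delta.
rewrite LE remE (tildeED a0)//; last exact: contFZ.
rewrite (tildeEZ a0 (-1) cTl) mulN1r.
have -> : tildeE alpha Tl = T + (T1 * tildeE alpha B0 + (T2 * tildeE alpha (sq_rest ord0) + T3 * tildeE alpha B2)).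
  rewrite (tildeED a0) ?tildeE_cst//; [|exact: contF_cst|by apply: contFD; [exact: contFZ|apply: contFD; exact: contFZ]].
  rewrite (tildeED a0); [|exact: contFZ|by apply: contFD; exact: contFZ].
  rewrite (tildeED a0); [|exact: contFZ|exact: contFZ].
  by rewrite !(tildeEZ a0).
have EL : Lm x y h f = T by [].
have E1 : R1 x y h f alpha ord0 = T1 * tildeE alpha B0.
  rewrite /R1 -/B0 /T1 /mean -mulrA mulrC; congr (_ * _ * _).
  by apply: eq_bigr => a _; rewrite (grad_loss dh df) -scalemxAl mx11Z.
have EQ a : EquadH x a (hess (phi a) (x a)) = (derive1 h (f (x a)) - y a) * EquadH x a (hess f (x a))
    + derive1 (derive1 h) (f (x a)) * (grad f (x a) *m EXX x a *m (grad f (x a))^T) 0 0.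
  by rewrite (hess_loss dh df) EquadH_rank1.
have EH a : (EX x a *m hess (phi a) (x a) *m (EX x a)^T) 0 0 =
    (derive1 h (f (x a)) - y a) * (EX x a *m hess f (x a) *m (EX x a)^T) 0 0
    + derive1 (derive1 h) (f (x a)) * (grad f (x a) *m (EX x a)^T *m EX x a *m (grad f (x a))^T) 0 0.
  by rewrite (hess_loss dh df) quad_rank1 !mulmxA.
have E23 : R2 x h f alpha ord0 + R3 x y h f alpha ord0 = T2 * tildeE alpha (sq_rest ord0) + T3 * tildeE alpha B2.
  rewrite /R2 /R3 -/B2 /T2 /T3 /mean.
  under [X in _ = _ * (_ * X) * _ + _]eq_bigr => a _ do rewrite EQ.
  under [X in _ = _ + _ * (_ * X) * _]eq_bigr => a _ do rewrite EH.
  rewrite !big_split /= !invfM.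
  move: (\sum_(i < m) _) (\sum_(i < m) _) (\sum_(i < m) _) (\sum_(i < m) _) (tildeE _ _) (tildeE _ _) => ? ? ? ? ? ?.
  ring.
rewrite EL E1 -[T + _ + _ + _]addrA E23; ring.
Qed.
End Mixup.

Local Close Scope classical_set_scope.

Theorem theorem5 (R : realType) (p m n : nat) (hn : (2 <= n)%N)
  (x : 'I_m -> 'rV[R]_p) (y : 'I_m -> R)
  (Theta : Type) (f : Theta -> 'rV[R]_p -> R) (h : R -> R)
  (alpha : 'I_n -> R) :
  (forall t : R, derivable h t 1 /\ derivable (derive1 h) t 1) ->
  (forall (th : Theta) (z : 'rV[R]_p),
      differentiable (f th) z /\
      forall v : 'rV[R]_p, differentiable ('D_v (f th)) z) ->
  (forall k, 0 < alpha k) ->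
  forall th : Theta,
  let k0 : 'I_n := Ordinal (two_le_gt0 hn) in
  (* the remainder is o(||(lambda_2,...,lambda_n)||^2) for every index tuple *)
  (forall (i : {ffun 'I_n -> 'I_m}) (eps : R), 0 < eps ->
     exists2 d : R, 0 < d &
       forall lam : 'I_n -> R, (forall k, k != k0 -> `|lam k| < d) ->
         `|taylor_rem x y h (f th) k0 i lam| <= eps * sq_rest k0 lam)
  /\
  Lnmix x y h (f th) alpha =
    Lm x y h (f th) + R1 x y h (f th) alpha k0 + R2 x h (f th) alpha k0
    + R3 x y h (f th) alpha k0 + Rrem x y h (f th) alpha k0.
Proof.
move=> dh df a0 th k0; have dft := df th; split.
  by move=> i eps; exact: taylor_rem_littleo.
(* Writing n as [K.+2] gives the index type the arithmetic modulo n used for the cyclic shifts. *)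
move: @k0; case: n hn alpha a0 => [|[|K]]// hn' alpha' a0 k0.
rewrite (_ : k0 = ord0); last exact/val_inj.
exact: Lnmix_taylor.
Qed.
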